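(* Let $S$ be a semitopological semigroup. If $WAP(S)\cap LUC(S)$ has a left invariant mean, then $S$ has the following fixed point property: $(F^{\ast})$: Whenever $S$ acts on a nonempty weakly compact convex subset $K$ of a Banach space and the action is jointly weakly continuous, weakly quasi-equicontinuous and nonexpansive, then $K$ contains a common fixed point for $S$, i.e. an element $x\in K$ with $s\cdot x=x$ for every $s\in S$.
   Context: A semitopological semigroup is a semigroup $S$ with a Hausdorff topology such that for each $t\in S$ the mappings $s\mapsto ts$ and $s\mapsto st$ from $S$ to $S$ are continuous. $\ell^\infty(S)$ is the Banach space of bounded complex-valued functions on $S$ with the supremum norm, and $C(S)$ is its closed subalgebra of bounded continuous functions. For $s\in S$ and $f\in\ell^\infty(S)$, the left translation is $l_sf(t)=f(st)$, $t\in S$. $WAP(S)$ is the space of weakly almost periodic functions, i.e. all $f\in C(S)$ such that $\{l_sf:s\in S\}$ is relatively compact in the weak topology of $C(S)$. $LUC(S)$ is the space of left uniformly continuous functions, i.e. all $f\in C(S)$ such that the mapping $s\mapsto l_sf$ from $S$ to $C(S)$ is continuous when $C(S)$ has the sup norm topology. A left invariant mean (LIM) on a closed linear translation-invariant subspace $X$ of $\ell^\infty(S)$ containing the constants is a functional $m\in X^*$ with $\|m\|=m(1)=1$ and $m(l_sf)=m(f)$ for all $s\in S$, $f\in X$. An action of $S$ on $K$ (from the left) is a map $S\times K\to K$, $(s,x)\mapsto s\cdot x$, with $s\cdot(s'\cdot x)=(ss')\cdot x$ for all $s,s'\in S$, $x\in K$. For $K$ a subset of a Banach space $E$, the action is: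 nonexpansive if $\|s\cdot x-s\cdot y\|\le\|x-y\|$ for all $x,y\in K$, $s\in S$; jointly weakly continuous if the map $S\times K\to K$, $(s,x)\mapsto s\cdot x$, is continuous when $K$ carries the weak topology of $E$ and $S\times K$ the product topology; weakly quasi-equicontinuous if, when $K$ carries the weak topology of $E$, the closure of $\{x\mapsto s\cdot x : s\in S\}$ in $K^K$ with the product topology consists only of continuous mappings $K\to K$. *)

(* Defs.v *)
From HB Require Import structures.
From mathcomp Require Import all_boot all_order all_algebra.
From mathcomp Require Import complex.
From mathcomp Require Import all_classical all_reals all_analysis.

Set Implicit Arguments.
Unset Strict Implicit.
Unset Printing Implicit Defensive.

Import Order.TTheory GRing.Theory Num.Theory.
Import numFieldNormedType.Exports.
Import ComplexField.Normc.

Local Open Scope classical_set_scope.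
Local Open Scope ring_scope.
Local Open Scope complex_scope.

HB.mixin Record isSemitopological S & Topological S & Semigroup S := {
  semitopological_hausdorff : hausdorff_space S ;
  mulg_continuousl : forall t : S, continuous (fun s : S => (t * s)%g) ;
  mulg_continuousr : forall t : S, continuous (fun s : S => (s * t)%g)
}.

#[short(type="semitopSemigroupType")]
HB.structure Definition SemitopSemigroup :=
  {S of Topological S & Semigroup S & isSemitopological S}.

Definition dual (K : numFieldType) (E : normedModType K) :=
  {phi : {linear E -> K^o} | continuous (phi : E -> K^o)}.

(* E with the coarsest topology making all of E^* continuous. *)
Definition weak (K : numFieldType) (E : normedModType K) : Type := E.

HB.instance Definition _ (K : numFieldType) (E : normedModType K) :=
  Choice.on (weak E).

HB.instance Definition _ (K : numFieldType) (E : normedModType K) :=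
  Topological.copy (weak E)
    (sup_topology (fun phi : dual E =>
      Topological.class (initial_topology (sval phi : E -> K^o)))).

Section Cb.
Variables (R : realType) (S : topologicalType).

Lemma normc_ge0 (z : R[i]) : 0 <= normc z.
Proof. by case: z => a b; exact: sqrtr_ge0. Qed.

Lemma normcE (z : R[i]) : `|z| = (normc z)%:C.
Proof. by []. Qed.

Definition Cb_pred : {pred S -> R[i]^o} :=
  mem [set f : S -> R[i]^o | continuous f /\ bounded_fun f].

Lemma bounded_complexP (f : S -> R[i]^o) :
  bounded_fun f <-> exists M : R, forall s, normc (f s) <= M.
Proof.
have nE (z : R[i]^o) (x : R) : (`|z| <= x%:C) = (normc z <= x).
  by rewrite -lecR.
split=> [[M [Mreal fM]]|[M fM]].
  exists (complex.Re M + 1) => s; rewrite -nE; apply: fM => //.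
  rewrite -[X in X < _]RRe_real// ltcR ltrDl//.
exists M%:C; split=> [|x Mx s _ /=]; first by apply/complex_realP; exists M.
by apply: le_trans (ltW Mx); rewrite nE.
Qed.

Lemma Cb_predP (f : S -> R[i]^o) :
  reflect (continuous f /\ exists M : R, forall s, normc (f s) <= M)
          (f \in Cb_pred).
Proof.
apply: (iffP idP); rewrite inE.
  by case=> cf /bounded_complexP bf.
by case=> cf /bounded_complexP bf.
Qed.

Lemma Cb_submod_closed : submod_closed Cb_pred.
Proof.
split.
  apply/Cb_predP; split; first exact: cst_continuous.
  by exists 0 => s; rewrite normc0.
move=> a f g /Cb_predP[cf [M fM]] /Cb_predP[cg [N gN]]; apply/Cb_predP; split.
  move=> x; apply: cvgD; last exact: cg.
  by apply: cvgZr; exact: cf.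
exists (normc a * M + N) => s; apply: (le_trans (le_normcD _ _)).
by rewrite normcM lerD ?ler_wpM2l ?normc_ge0.
Qed.

HB.instance Definition _ := GRing.isSubmodClosed.Build _ _ Cb_pred
  Cb_submod_closed.

Record Cb := MkCb { Cb_fun :> S -> R[i]^o ; Cb_funP : Cb_fun \in Cb_pred }.

HB.instance Definition _ := [isSub for Cb_fun].
HB.instance Definition _ := [Choice of Cb by <:].
HB.instance Definition _ := [SubChoice_isSubLmodule of Cb by <:].

(* MathComp norms take values in the scalars, so the norm of C(S) is the real
   number [supnorm f] seen in R[i]. For empty S, [sup set0 = 0]. *)
Definition supnorm (f : Cb) : R := sup (range (fun s => normc (f s))).

Lemma supnorm_ub (f : Cb) (s : S) : normc (f s) <= supnorm f.
Proof.
have /Cb_predP[_ [M fM]] := Cb_funP f.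
by apply: ub_le_sup; [exists M => _ [t _ <-]|exists s].
Qed.

Lemma supnorm_le (f : Cb) (M : R) : 0 <= M ->
  (forall s, normc (f s) <= M) -> supnorm f <= M.
Proof.
move=> M0 fM; rewrite /supnorm.
have [[s _]|/set0P/negP/negPn/eqP S0] := pselect ([set: S] !=set0).
  apply: ge_sup; first by exists (normc (f s)), s.
  by move=> _ [t _ <-].
by rewrite S0 image_set0 sup0.
Qed.

Lemma supnorm_ge0 (f : Cb) : 0 <= supnorm f.
Proof.
rewrite /supnorm.
have [[s _]|/set0P/negP/negPn/eqP S0] := pselect ([set: S] !=set0).
  exact: le_trans (normc_ge0 (f s)) (supnorm_ub f s).
by rewrite S0 image_set0 sup0.
Qed.

Lemma supnormD (f g : Cb) :
  (supnorm (f + g))%:C <= (supnorm f)%:C + (supnorm g)%:C.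
Proof.
rewrite -rmorphD lecR; apply: supnorm_le => [|s].
  by rewrite addr_ge0 ?supnorm_ge0.
by apply: (le_trans (le_normcD _ _)); apply: lerD; exact: supnorm_ub.
Qed.

Lemma supnormZ (a : R[i]) (f : Cb) :
  (supnorm (a *: f))%:C = `|a| * (supnorm f)%:C.
Proof.
have leZ (b : R[i]) (g : Cb) : supnorm (b *: g) <= normc b * supnorm g.
  apply: supnorm_le => [|s]; first by rewrite mulr_ge0 ?normc_ge0 ?supnorm_ge0.
  by rewrite normcM; apply: ler_wpM2l; [exact: normc_ge0|exact: supnorm_ub].
rewrite normcE -rmorphM; congr _%:C; apply/eqP; rewrite eq_le leZ /=.
have [->|a0] := eqVneq a 0; first by rewrite normc0 mul0r supnorm_ge0.
have na0 : 0 < normc a.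
  rewrite lt_def normc_ge0 andbT; apply: contra a0 => /eqP na0.
  by apply/eqP; exact: eq0_normc.
by rewrite mulrC -ler_pdivlMr// mulrC -normcV (le_trans _ (leZ _ _))//
  scalerA mulVf// scale1r.
Qed.

Lemma supnorm_eq0 (f : Cb) : (supnorm f)%:C = 0 -> f = 0.
Proof.
move=> [f0]; apply/val_inj/funext => s; apply: eq0_normc.
by apply/eqP; rewrite eq_le normc_ge0 andbT -f0 supnorm_ub.
Qed.

HB.instance Definition _ :=
  Lmodule_isNormed.Build R[i] Cb supnormD supnormZ supnorm_eq0.

Lemma cst_Cb (c : R[i]) : (cst c : S -> R[i]^o) \in Cb_pred.
Proof.
by apply/Cb_predP; split; [exact: cst_continuous|exists (normc c)].
Qed.

Definition Cb_cst (c : R[i]) : Cb := MkCb (cst_Cb c).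

End Cb.

Section Functions.
Variables (R : realType) (S : semitopSemigroupType).
Local Notation C := (Cb R S).

Lemma ltrans_Cb (s : S) (f : C) :
  (fun t => f (s * t)%g : R[i]^o) \in @Cb_pred R S.
Proof.
have /Cb_predP[cf [M fM]] := Cb_funP f.
apply/Cb_predP; split; last by exists M.
by move=> t; apply: (continuous_comp (mulg_continuousl s t)); exact: cf.
Qed.

Definition ltrans (s : S) (f : C) : C := MkCb (ltrans_Cb s f).

Definition WAP : set C :=
  [set f | precompact (range (fun s => ltrans s f) : set (weak C))].

Definition LUC : set C := [set f | continuous (fun s => ltrans s f)].

(* A functional on the subspace X of C(S) is represented by a total function of
   which only the values on X matter; it is in X^* iff this norm is finite. *)
Definition functional_norm (X : set C) (m : C -> R[i]) : \bar R :=
  ereal_sup [set (normc (m f))%:E | f in [set f | X f /\ `|f| <= 1]].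

Definition left_invariant_mean (X : set C) (m : C -> R[i]) : Prop :=
  [/\ forall a f g, X f -> X g -> m (a *: f + g) = a * m f + m g,
      functional_norm X m = 1%E,
      m (Cb_cst S 1) = 1 &
      forall s f, X f -> m (ltrans s f) = m f].

End Functions.

Arguments WAP : clear implicits.
Arguments LUC : clear implicits.

(* Since A is a set of [weak E], the type of its elements has the topology
   induced by the weak topology of E. *)
Section Actions.
Variables (S : semitopSemigroupType) (K : numFieldType) (E : normedModType K).
Variables (A : set (weak E)) (act : S -> A -> A).

Definition is_action := forall s s' x, act s (act s' x) = act (s * s')%g x.

Definition nonexpansive := forall s (x y : A),
  `|(\val (act s x) : E) - (\val (act s y) : E)| <=
    `|(\val x : E) - (\val y : E)|.

Definition jointly_weakly_continuous :=
  continuous (fun p : S * A => act p.1 p.2).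

Definition weakly_quasi_equicontinuous :=
  forall g : A -> A,
    closure (range act : set {ptws A -> A}) g -> continuous g.

End Actions.

(* The fixed point property for Banach spaces over the scalar field K, which is
   meant to be R or R[i]; over R[i], [0 <= t <= 1] forces t to be real, so that
   [convex_set] is convexity in the usual sense. *)
Definition Fstar (S : semitopSemigroupType) (K : numFieldType) : Prop :=
  forall (E : completeNormedModType K) (A : set (weak E)) (act : S -> A -> A),
    A !=set0 -> compact A -> convex_set (A : set (convex_lmodType E)) ->
    is_action act -> jointly_weakly_continuous act ->
    weakly_quasi_equicontinuous act -> nonexpansive act ->
    exists x : A, forall s, act s x = x.

(* Main.v *)
Require Import Defs.
From HB Require Import structures.
From mathcomp Require Import all_boot all_order all_algebra.
From mathcomp Require Import complex.
From mathcomp Require Import all_classical all_reals all_analysis.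
From mathcomp Require Import ring lra.

Set Implicit Arguments.
Unset Strict Implicit.
Unset Printing Implicit Defensive.

Import Order.TTheory GRing.Theory Num.Theory.
Import numFieldNormedType.Exports.
Import ComplexField.Normc.

Local Open Scope classical_set_scope.
Local Open Scope ring_scope.
Local Open Scope complex_scope.

(** The invariant mean makes the pointwise closure of the action behave, on a
minimal set, like a compact group of isometries. A weakly compact set on which
such a group acts transitively is totally bounded in norm, and on a totally
bounded set a barycenter argument leaves no room for two different points.

Let [X] be the weakly compact convex set, and let [Sigma] be the closure of the
action in the product topology; by weak quasi-equicontinuity it is a compact
set of continuous maps, and a semigroup under composition. A continuous
[f : X -> R] and a point [x] give the function [s |-> f (s x)] on [S]. It is left
uniformly continuous, because a jointly continuous function on [S * X] with [X]
compact is continuous in [s] uniformly over [X] ([orb_LUC]). It is weakly almost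
periodic by the theorem of Grothendieck that a bounded, pointwise compact set of
continuous functions is weakly compact ([grothendieck], [orb_WAP]). Behind that
theorem are a Fatou lemma for the positive variation of a functional
([posvar_limsup]), which takes the place of integration, and a double limit
argument ([double_limit_absurd]). Composing with the left invariant mean yields a positive
normalized functional [psi] on C(X), concentrated on the orbit of [x] and
invariant under [S] ([orbit_mean_of_LIM]). Grothendieck's theorem applies to
[psi] as well, so [psi] is invariant under [Sigma] ([mean_invariant]).

Take [K] minimal among the closed convex invariant subsets and [F] minimal among
the closed invariant subsets of [K], with [x] in [F]. The support of [psi] is
[F], hence every element of [Sigma] maps [F] onto [F] ([Sigma_surjective]). An
idempotent that maps [F] onto [F] fixes [F] pointwise; since every closed
subsemigroup contains an idempotent (Ellis and Numakura), every element of
[Sigma] is invertible on [F] ([left_inverse]), and being nonexpansive together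
with its inverse, it is isometric there.

The set [F] is totally bounded in norm ([minimal_totally_bounded]). A sequence in
[F] with separated terms is reached from one point by a countable subsemigroup;
the closure of the corresponding orbit lies in the norm closed span of a
countable set, by the Hahn-Banach theorem, so the Baire theorem provides a
relatively weakly open piece of small norm diameter. A cluster point of the
sequence is carried into this piece by an isometry of [F], which then carries two
terms of the sequence into it, although they are far apart.

Finally, if the diameter [d] of [F] were positive, the barycenter of a finite
net of [F] would have distance at most some [r < d] from all points of [F]. The
points of [K] with this property form a closed convex invariant set, so they fill
[K] by minimality; but then [F] has diameter at most [r]. Hence [F] is a single
fixed point ([fixed_point_of_means]).

The norm and the weak topology interact only through real-linear functionals
dominated by the norm, so one argument serves real and complex spaces
([fixed_point_of_LIM]). *)

(** * Compactness, minimal closed sets and the Hahn-Banach theorem *)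

(** The finite intersection property for downward directed families. Chains,
decreasing sequences and the zero sets of nonnegative functions all have this
form, which spares the finite subfamilies. *)
Lemma compact_directed (X : topologicalType) (K : set X) (C : set (set X)) :
  compact K -> C !=set0 -> (forall A, C A -> closed A) ->
  (forall A, C A -> K `&` A !=set0) ->
  (forall A B, C A -> C B -> exists2 D, C D & D `<=` A `&` B) ->
  exists2 x, K x & forall A, C A -> A x.
Proof.
move=> cK [A0 CA0] Ccl Cne Cdir.
pose F := filter_from C (fun A => K `&` A).
have FF : ProperFilter F.
  apply: filter_from_proper => //; apply: filter_from_filter; first by exists A0.
  move=> A B CA CB; have [D CD sD] := Cdir _ _ CA CB; exists D => //.
  by move=> x [Kx /sD[Ax Bx]].
have [x [Kx clx]] := cK F FF (ex_intro2 _ _ A0 CA0 (@subIsetl _ K A0)).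
exists x => // A CA; apply: (Ccl _ CA) => B /clx; apply.
by exists A => //; exact: subIsetr.
Qed.

(** Zorn's lemma: by compactness the intersection of a chain of nonempty closed
sets is nonempty. The property [Q] is invariance, invariance together with
convexity, or being a subsemigroup. *)
Lemma compact_minimal (X : topologicalType) (Q : set (set X)) (K : set X) :
  compact K -> closed K -> K !=set0 -> Q K ->
  (forall C : set (set X), C !=set0 -> C `<=` Q -> Q (\bigcap_(A in C) A)) ->
  exists M, [/\ M `<=` K, closed M, M !=set0, Q M &
    forall N, N `<=` M -> closed N -> N !=set0 -> Q N -> N = M].
Proof.
move=> cK clK K0 QK QI.
pose P := [set A | [/\ A `<=` K, closed A, A !=set0 & Q A]].
pose T := {A | P A}.
pose r (a b : T) := `[< sval b `<=` sval a >].
have := @Zorn T r; case.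
- by move=> a; apply/asboolP.
- by move=> a b c /asboolP ab /asboolP bc; apply/asboolP; exact: subset_trans ab.
- move=> [a Pa] [b Pb] /asboolP/= ba /asboolP/= ab.
  have eab : a = b by apply/seteqP.
  by subst b; congr exist; exact: Prop_irrelevance.
- move=> C Ctot; have [->|/set0P[c0 Cc0]] := eqVneq C set0.
    by exists (exist P K (And4 (@subset_refl _ K) clK K0 QK)).
  pose D := [set sval c | c in C].
  have D0 : D !=set0 by exists (sval c0), c0.
  have DP : D `<=` P by move=> _ [c _ <-]; exact: svalP.
  suff PD : P (\bigcap_(A in D) A).
    exists (exist P _ PD) => c Cc; apply/asboolP => /= x; apply.
    by exists c.
  split.
  + by move=> x Dx; have [+ _ _ _] := svalP c0; apply; apply: Dx; exists c0.
  + by apply: closed_bigI => A /DP[].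
  + have [| | |x Kx Dx] := @compact_directed X K D cK D0; last by exists x.
    * by move=> A /DP[].
    * by move=> A /DP[AK _ [x Ax] _]; exists x; split => //; exact: AK.
    * move=> _ _ [a Ca <-] [b Cb <-].
      by have [/asboolP ab|/asboolP ba] := Ctot _ _ Ca Cb;
        [exists (sval b); [exists b|]|exists (sval a); [exists a|]] => // x ?;
        split => //; [exact: ab|exact: ba].
  + by apply: QI => // A /DP[].
- move=> [M PM] Mmax; have [MK clM M0 QM] := PM.
  exists M; split => // N NM clN N0 QN.
  have PN : P N by split => //; exact: subset_trans MK.
  by have [] := Mmax (exist P N PN) (asboolT NM).
Qed.

(** The Ellis-Numakura lemma. For [a] in a minimal closed subsemigroup [M], the
sets of all [mul b a] with [b] in [M], and of all [b] in [M] with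
[mul b a = a], are again closed subsemigroups, so both are equal to [M]. *)
Lemma idempotent_exists (Y : topologicalType) (mul : Y -> Y -> Y) (K : set Y) :
  hausdorff_space Y -> associative mul ->
  (forall a, continuous (mul^~ a)) ->
  compact K -> K !=set0 -> (forall a b, K a -> K b -> K (mul a b)) ->
  exists2 e, K e & mul e e = e.
Proof.
move=> hY mulA cmul cK K0 Kmul.
pose Q := [set A : set Y | forall a b, A a -> A b -> A (mul a b)].
have clK := compact_closed hY cK.
have [||M [MK clM [a Ma] QM Mmin]] := @compact_minimal Y Q K cK clK K0.
- exact: Kmul.
- by move=> C _ CQ a b Ca Cb A CA; apply: (CQ _ CA); [exact: Ca|exact: Cb].
have cM : compact M by exact: subclosed_compact clM cK MK.
(* That [a] is of the form [mul b a] makes the stabilizer below nonempty. *)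
have sMM : [set mul b a | b in M] = M.
  apply: Mmin.
  - by move=> _ [b Mb <-]; exact: QM.
  - apply: compact_closed => //; apply: continuous_compact => //.
    by apply: continuous_subspaceT => x; exact: cmul.
  - by exists (mul a a), a.
  - move=> _ _ [b Mb <-] [c Mc <-]; exists (mul (mul b a) c).
      by apply: (QM _ _ _ Mc); exact: (QM _ _ Mb Ma).
    by rewrite -!mulA.
have stabM : M `&` (mul^~ a @^-1` [set a]) = M.
  apply: Mmin.
  - by move=> x [].
  - apply: closedI => //; apply: preimage_closed; first by move=> x _; exact: cmul.
    exact: accessible_closed_set1 (hausdorff_accessible hY) _.
  - by move: Ma; rewrite -{1}sMM => -[b Mb ba]; exists b.
  - move=> b c [Mb /= ba] [Mc /= ca]; split; first exact: QM.
    by rewrite /= -mulA ca ba.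
by exists a; [exact: MK|move: Ma; rewrite -{1}stabM => -[]].
Qed.

(** The Baire category theorem: if no [C n] contained a relatively open piece of
[K], regularity would allow to shrink open sets so that they avoid the [C n] one
after the other, and compactness would leave a point in none of them. *)
Lemma compact_baire (X : topologicalType) (K : set X) (C : nat -> set X) :
  hausdorff_space X -> compact [set: X] -> closed K -> K !=set0 ->
  (forall n, closed (C n)) -> K `<=` \bigcup_n C n ->
  exists n, exists U, [/\ open U, K `&` U !=set0 & K `&` U `<=` C n].
Proof.
move=> hX cX clK K0 clC KC; apply: contrapT => noU.
have regX x (U : set X) : open U -> U x ->
    exists V, [/\ open V, V x & closure V `<=` U].
  move=> oU Ux.
  have [||V nV VU] := compact_normal hX cX (A := [set x]) _ (t := U).
  - exact: accessible_closed_set1 (hausdorff_accessible hX) _.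
  - by move=> _ ->; exact: open_nbhs_nbhs.
  have := nV x erefl; rewrite nbhsE => -[W [oW Wx] WV].
  by exists W; split => //; apply: subset_trans VU; exact: closure_subset.
have step n (U : set X) : exists V : set X, open U -> K `&` U !=set0 ->
    [/\ open V, K `&` V !=set0 & closure V `<=` U `\` C n].
  have [[oU KU]|h] := pselect (open U /\ K `&` U !=set0); last first.
    by exists set0 => ? ?; case: h.
  have : ~ (K `&` U `<=` C n) by move=> h; apply: noU; exists n, U.
  move/existsNP => [x /not_implyP[[Kx Ux] nCx]].
  have [||V [oV Vx VU]] := regX x (U `&` ~` C n) => //.
    by apply: openI => //; exact: closed_openC.
  by exists V => _ _; split => //; exists x.
pose nxt n U := sval (cid (step n U)).
pose fix W n := if n is m.+1 then nxt m (W m) else [set: X].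
have WP n : open (W n) /\ K `&` W n !=set0.
  elim: n => [|n [oW KW]]; first by split; [exact: openT|rewrite setIT].
  by have [] := svalP (cid (step n (W n))) oW KW.
have WS n : closure (W n.+1) `<=` W n `\` C n.
  by have [oW KW] := WP n; have [] := svalP (cid (step n (W n))) oW KW.
have Wle m n : (m <= n)%N -> W n `<=` W m.
  elim: n => [|n IH]; first by rewrite leqn0 => /eqP ->.
  rewrite leq_eqVlt => /predU1P[->//|]; rewrite ltnS => /IH; apply: subset_trans.
  by move=> x /subset_closure/WS[].
have cK : compact K by exact: subclosed_compact clK cX _.
have [| | | |x Kx Wx] :=
    @compact_directed X K (range (fun n => closure (W n))) cK.
- by exists (closure (W 0%N)), 0%N.
- by move=> _ [n _ <-]; exact: closed_closure.
- move=> _ [n _ <-]; have [_ [x [Kx Wx]]] := WP n.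
  by exists x; split => //; exact: subset_closure.
- move=> _ _ [m _ <-] [n _ <-]; exists (closure (W (maxn m n))).
    by exists (maxn m n).
  by rewrite subsetI; split; apply: closure_subset; apply: Wle;
    rewrite leq_max leqnn ?orbT.
have [n _ Cnx] := KC x Kx.
by have [] : (W n `\` C n) x by apply: WS; apply: Wx; exists n.+1.
Qed.

(** For constructions by recursion in which a new term has to respect all the
terms chosen before it. *)
Lemma seq_choice (T : Type) (P : seq T -> T -> Prop) :
  (forall l, exists x, P l x) ->
  exists u : nat -> T, forall n, P (mkseq u n) (u n).
Proof.
move=> /choice[f fP].
pose fix L n := if n is m.+1 then rcons (L m) (f (L m)) else [::].
exists (fun n => f (L n)) => n; suff -> : mkseq (fun n => f (L n)) n = L n by [].
by elim: n => // n IH; rewrite mkseqS IH.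
Qed.

Lemma continuous_bounded (R : realType) (X : topologicalType) (x : X)
    (f : X -> R) :
  compact [set: X] -> continuous f -> exists M, forall y, `|f y| <= M.
Proof.
move=> cX cf; have cn : continuous (fun y => `|f y|).
  by move=> y; apply: cvg_norm; exact: cf.
have [| |c _ h] := @compact_EVT_max X R (fun y => `|f y|) setT _ cX.
- by exists x.
- exact: continuous_subspaceT.
by exists `|f c| => y; apply: h; rewrite inE.
Qed.

Section HahnBanach.
Variables (R : realType) (V : lmodType R).
Implicit Types p q : V -> R.

Definition sublinear p :=
  (forall x y, p (x + y) <= p x + p y) /\
  (forall t x, 0 <= t -> p (t *: x) = t * p x).

Lemma sublinear0 p : sublinear p -> p 0 = 0.
Proof. by move=> [_ ph]; rewrite -(scale0r 0) ph// mul0r. Qed.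

Lemma sublinear_lbound p x : sublinear p -> - p (- x) <= p x.
Proof.
move=> sp; have [pD _] := sp; have := pD (- x) x.
by rewrite addNr (sublinear0 sp); lra.
Qed.

(** A sublinear functional below [p] which is at most [- p z] at [- z]
([tiltN]). A minimal sublinear functional is equal to all its tilts, hence odd,
hence linear. *)
Definition tilt p z x :=
  inf [set p (x + t *: z) - t * p z | t in [set t : R | 0 <= t]].

Lemma tilt_has_inf p z x : sublinear p ->
  has_inf [set p (x + t *: z) - t * p z | t in [set t : R | 0 <= t]].
Proof.
move=> sp; have [pD ph] := sp; split.
  by exists (p (x + 0 *: z) - 0 * p z); exists 0 => /=.
exists (- p (- x)) => _ [t /= t0 <-].
have := pD (- x) (x + t *: z); rewrite addrA addNr add0r ph//; lra.
Qed.

Lemma tilt_le p z x t : sublinear p -> 0 <= t ->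
  tilt p z x <= p (x + t *: z) - t * p z.
Proof.
move=> sp t0; apply: ge_inf; last by exists t.
exact: (tilt_has_inf z x sp).2.
Qed.

Lemma tilt_sublinear p z : sublinear p -> sublinear (tilt p z).
Proof.
move=> sp; have [pD ph] := sp.
have tiltD x y : tilt p z (x + y) <= tilt p z x + tilt p z y.
  rewrite -lerBlDr; apply: lb_le_inf; first exact: (tilt_has_inf z x sp).1.
  move=> _ [s /= s0 <-]; rewrite lerBlDr -lerBlDl.
  apply: lb_le_inf; first exact: (tilt_has_inf z y sp).1.
  move=> _ [t /= t0 <-]; rewrite lerBlDl.
  apply: (le_trans (tilt_le z (x + y) sp (addr_ge0 s0 t0))).
  have := pD (x + s *: z) (y + t *: z).
  rewrite addrACA -scalerDl; lra.
have tiltZ t x : 0 < t -> tilt p z (t *: x) <= t * tilt p z x.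
  move=> t0; rewrite -ler_pdivrMl//; apply: lb_le_inf.
    exact: (tilt_has_inf z x sp).1.
  move=> _ [s /= s0 <-]; rewrite ler_pdivrMl//.
  apply: (le_trans (tilt_le z (t *: x) sp (mulr_ge0 (ltW t0) s0))).
  by rewrite -scalerA -scalerDr (ph _ _ (ltW t0)) mulrBr mulrA.
split=> // t x; rewrite le_eqVlt => /predU1P[<-|t0].
  rewrite scale0r mul0r; apply/eqP; rewrite eq_le; apply/andP; split.
    apply: (le_trans (tilt_le z 0 sp (lexx 0))).
    by rewrite scale0r addr0 mul0r subr0 sublinear0.
  apply: lb_le_inf; first exact: (tilt_has_inf z 0 sp).1.
  by move=> _ [s /= s0 <-]; rewrite add0r ph// subrr.
apply/eqP; rewrite eq_le tiltZ//=.
have ti0 : 0 < t^-1 by rewrite invr_gt0.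
have := tiltZ t^-1 (t *: x) ti0.
by rewrite scalerA mulVf ?gt_eqF// scale1r ler_pdivlMl.
Qed.

Lemma tilt_le_id p z x : sublinear p -> tilt p z x <= p x.
Proof.
by move=> sp; have := tilt_le z x sp (lexx 0); rewrite scale0r addr0 mul0r subr0.
Qed.

Lemma tiltN p z : sublinear p -> tilt p z (- z) <= - p z.
Proof.
move=> sp; have := tilt_le z (- z) sp ler01.
by rewrite scale1r addNr sublinear0// mul1r sub0r.
Qed.

(** The pointwise infimum of a chain of sublinear functionals below [q] is finite,
because each of them is at least [- q (- x)] at [x], and it is sublinear because
two members of the chain can be replaced by the smaller one. *)
Lemma minimal_sublinear q : sublinear q ->
  exists p, [/\ sublinear p, forall x, p x <= q x &
    forall p', sublinear p' -> (forall x, p' x <= p x) -> p' = p].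
Proof.
move=> sq; pose P := [set p | sublinear p /\ forall x, p x <= q x].
pose T := {p | P p}.
pose r (a b : T) := `[< forall x, sval b x <= sval a x >].
have := @Zorn T r; case.
- by move=> a; apply/asboolP.
- move=> a b c /asboolP ab /asboolP bc; apply/asboolP => x.
  exact: le_trans (bc x) (ab x).
- move=> [a Pa] [b Pb] /asboolP/= ba /asboolP/= ab.
  have eab : a = b by apply/funext => x; apply/eqP; rewrite eq_le ba ab.
  by subst b; congr exist; exact: Prop_irrelevance.
- move=> C Ctot; have [->|/set0P[c0 Cc0]] := eqVneq C set0.
    by exists (exist P q (conj sq (fun x => lexx (q x)))).
  pose m x := inf [set sval c x | c in C].
  have mI x : has_inf [set sval c x | c in C].
    split; first by exists (sval c0 x), c0.
    exists (- q (- x)) => _ [c Cc <-]; have [sc cq] := svalP c.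
    by apply: le_trans (sublinear_lbound x sc); rewrite lerN2.
  have mle c x : C c -> m x <= sval c x.
    by move=> Cc; apply: ge_inf; [exact: (mI x).2|exists c].
  have Pm : P m.
    split; last first.
      by move=> x; apply: (le_trans (mle _ x Cc0)); have [_ ->] := svalP c0.
    have mZ t x : 0 < t -> m (t *: x) <= t * m x.
      move=> t0; rewrite -ler_pdivrMl//; apply: lb_le_inf; first exact: (mI x).1.
      move=> _ [c Cc <-]; rewrite ler_pdivrMl//; have [[_ ch] _] := svalP c.
      by rewrite -(ch _ _ (ltW t0)); exact: mle.
    split.
      move=> x y; rewrite -lerBlDr; apply: lb_le_inf; first exact: (mI x).1.
      move=> _ [a Ca <-]; rewrite lerBlDr -lerBlDl.
      apply: lb_le_inf; first exact: (mI y).1.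
      move=> _ [b Cb <-]; rewrite lerBlDl.
      have [[aD _] _] := svalP a; have [[bD _] _] := svalP b.
      have [/asboolP ab|/asboolP ba] := Ctot _ _ Ca Cb.
        apply: (le_trans (mle _ _ Cb)); apply: (le_trans (bD _ _)).
        by rewrite lerD2r.
      apply: (le_trans (mle _ _ Ca)); apply: (le_trans (aD _ _)).
      by rewrite lerD2l.
    move=> t x; rewrite le_eqVlt => /predU1P[<-|t0].
      rewrite scale0r mul0r /m; have -> : [set sval c (0 : V) | c in C] = [set 0].
        apply/seteqP; split=> [_ [c Cc <-]|_ ->].
          by have [sc _] := svalP c; rewrite /= sublinear0.
        by exists c0 => //; have [sc _] := svalP c0; rewrite /= sublinear0.
      exact: inf1.
    apply/eqP; rewrite eq_le mZ//=.
    have ti0 : 0 < t^-1 by rewrite invr_gt0.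
    have := mZ t^-1 (t *: x) ti0.
    by rewrite scalerA mulVf ?gt_eqF// scale1r ler_pdivlMl.
  by exists (exist P m Pm) => c Cc; apply/asboolP => x; exact: mle.
- move=> [p Pp] pmin; have [sp pq] := Pp.
  exists p; split => // p' sp' p'p.
  have Pp' : P p' by split=> // x; exact: le_trans (p'p x) (pq x).
  by have [] := pmin (exist P p' Pp') (asboolT p'p).
Qed.

(** A minimal sublinear functional is linear; starting below the tilt of [q] in
the direction [x0] forces the value at [- x0] down to [- q x0]. *)
Lemma hahn_banach q (x0 : V) : sublinear q ->
  exists phi : V -> R, [/\ forall a x y, phi (a *: x + y) = a * phi x + phi y,
    forall x, phi x <= q x & phi x0 = q x0].
Proof.
move=> sq; have [p [sp ptq pmin]] := minimal_sublinear (tilt_sublinear x0 sq).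
have [pD ph] := sp.
have pN x : p (- x) = - p x.
  apply/eqP; rewrite eq_le; apply/andP; split; last first.
    by rewrite lerNl; exact: sublinear_lbound.
  rewrite -[leLHS](_ : tilt p x (- x) = _); first exact: tiltN.
  by rewrite (pmin _ (tilt_sublinear x sp))// => y; exact: tilt_le_id.
have pA x y : p (x + y) = p x + p y.
  apply/eqP; rewrite eq_le pD/=; have := pD (- x) (- y).
  by rewrite -opprD !pN; lra.
have pZ a x : p (a *: x) = a * p x.
  have [a0|a0] := leP 0 a; first exact: ph.
  by rewrite -[a]opprK scaleNr pN ph ?oppr_ge0 ?ltW// !mulNr.
exists p; split.
- by move=> a x y; rewrite pA pZ.
- by move=> x; apply: le_trans (ptq x) _; exact: tilt_le_id.
- apply/eqP; rewrite eq_le; apply/andP; split.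
    by apply: le_trans (ptq _) _; exact: tilt_le_id.
  rewrite -lerN2 -pN; exact: le_trans (ptq _) (tiltN _ sq).
Qed.

End HahnBanach.

(** * Grothendieck's theorem on pointwise compact families *)

(** The Riesz decomposition at a single point. *)
Lemma clamp_rest (R : realType) (s m M : R) : 0 <= m -> m <= M ->
  `|s| <= m + M -> `|s - Num.max (- m) (Num.min s m)| <= M.
Proof.
move=> m0 mM; rewrite !ler_norml => /andP[s1 s2].
have [sm|sm] := leP s m; last first.
  by have [|] := leP (- m) m => ?; apply/andP; split; lra.
by have [|] := leP (- m) s => ?; apply/andP; split; lra.
Qed.

Section BoundedFunctional.
Variables (R : realType) (X : topologicalType) (psi : (X -> R) -> R) (C : R).
Hypothesis psi_lin : forall (a : R) (f g : X -> R),
  continuous f -> continuous g ->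
  psi (fun y => a * f y + g y) = a * psi f + psi g.
Hypothesis psi_bd : forall (f : X -> R) (M : R),
  continuous f -> (forall y, `|f y| <= M) ->
  `|psi f| <= C * M.
Hypothesis C0 : 0 <= C.
Variable B : R.

Let psiD (f g : X -> R) : continuous f -> continuous g ->
  psi (fun y => f y + g y) = psi f + psi g.
Proof.
move=> cf cg; rewrite -[psi f]mul1r -psi_lin//; congr psi; apply/funext => y.
by rewrite mul1r.
Qed.

(** On nonnegative continuous functions this is the positive part of the
functional [psi]. *)
Definition posvar (g : X -> R) : R :=
  sup [set psi u | u in [set u | continuous u /\ forall y, `|u y| <= g y]].

Definition nonneg_le (g : X -> R) := forall y, 0 <= g y <= B.

Lemma posvar_has_sup g M : (forall y, 0 <= g y) -> (forall y, g y <= M) ->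
  has_sup [set psi u | u in [set u | continuous u /\ forall y, `|u y| <= g y]].
Proof.
move=> g0 gM; split.
  exists (psi (cst 0)), (cst 0) => //; split; first by move=> y; exact: cvg_cst.
  by move=> y; rewrite normr0.
exists (C * M) => _ [u [cu ug] <-]; apply: le_trans (ler_norm _) _.
by apply: psi_bd => // y; exact: le_trans (ug y) (gM y).
Qed.

Lemma posvar_ge g M u : (forall y, g y <= M) -> continuous u ->
  (forall y, `|u y| <= g y) -> psi u <= posvar g.
Proof.
move=> gM cu ug; apply: sup_upper_bound; last by exists u.
by apply: posvar_has_sup gM => y; exact: le_trans (ug y).
Qed.

Lemma posvar_le g M c : (forall y, 0 <= g y) -> (forall y, g y <= M) ->
  (forall u, continuous u -> (forall y, `|u y| <= g y) -> psi u <= c) ->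
  posvar g <= c.
Proof.
move=> g0 gM h; apply: ge_sup; first exact: (posvar_has_sup g0 gM).1.
by move=> _ [u [cu ug] <-]; exact: h.
Qed.

Lemma posvar_mono g g' M : (forall y, 0 <= g y) -> (forall y, g y <= g' y) ->
  (forall y, g' y <= M) -> posvar g <= posvar g'.
Proof.
move=> g0 gg' g'M; apply: (@posvar_le g M) => // [y|u cu ug].
  exact: le_trans (gg' y) (g'M y).
by apply: (@posvar_ge _ M) => // y; exact: le_trans (ug y) (gg' y).
Qed.

Lemma posvar_bound g M : (forall y, 0 <= g y) -> (forall y, g y <= M) ->
  posvar g <= C * M.
Proof.
move=> g0 gM; apply: (@posvar_le g M) => // u cu ug.
apply: le_trans (ler_norm _) _.
by apply: psi_bd => // y; exact: le_trans (ug y) (gM y).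
Qed.

(** If [u] is dominated by [a] and [v] by [b], then [u + v] is dominated by the sum
of the minimum and the maximum, so it splits into its truncation at the minimum
and a rest dominated by the maximum. *)
Lemma posvar_submodular a b : continuous a -> continuous b ->
  nonneg_le a -> nonneg_le b ->
  posvar a + posvar b <= posvar (a \min b) + posvar (a \max b).
Proof.
move=> ca cb ra rb.
have a0 y : 0 <= a y by case/andP: (ra y).
have b0 y : 0 <= b y by case/andP: (rb y).
have aB y : a y <= B by case/andP: (ra y).
have bB y : b y <= B by case/andP: (rb y).
rewrite -lerBrDr; apply: (@posvar_le a B) => // u cu ua.
rewrite lerBrDr -lerBrDl; apply: (@posvar_le b B) => // v cv vb.
rewrite lerBrDl.
have cmin : continuous (a \min b).
  by move=> y; apply: continuous_min; [exact: ca|exact: cb].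
pose w1 : X -> R := (fun y => - (a \min b) y) \max
  ((fun y => u y + v y) \min (a \min b)).
pose w2 : X -> R := fun y => u y + v y - w1 y.
have cw1 : continuous w1.
  move=> y; apply: continuous_max; first by apply: cvgN; exact: cmin.
  by apply: continuous_min; [apply: cvgD; [exact: cu|exact: cv]|exact: cmin].
have cw2 : continuous w2.
  by move=> y; apply: cvgB; [apply: cvgD; [exact: cu|exact: cv]|exact: cw1].
have -> : psi u + psi v = psi w1 + psi w2.
  by rewrite -!psiD//; congr psi; apply/funext => y; rewrite /w2; lra.
apply: lerD.
  apply: (@posvar_ge _ B) => // [y|y].
    by rewrite /= ge_min aB.
  have m0 : 0 <= Order.min (a y) (b y) by rewrite le_min a0 b0.
  rewrite /w1 /= ler_norml ge_max ge_min le_max lexx orbT andbT /=.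
  by rewrite lexx /= -subr_ge0 opprK addr_ge0.
apply: (@posvar_ge _ B) => // [y|y].
  by rewrite /= ge_max aB bB.
have m0 : 0 <= Order.min (a y) (b y) by rewrite le_min a0 b0.
apply: clamp_rest => //; first by rewrite ge_min !le_max lexx.
rewrite [leRHS](_ : _ = a y + b y); last by rewrite addr_min_max.
by apply: le_trans (ler_normD _ _) _; exact: lerD.
Qed.

Fixpoint runmax (k : nat -> X -> R) n m : X -> R :=
  if m is m'.+1 then runmax k n m' \max k (n + m)%N else k n.

Lemma runmax_ex k n m y :
  exists2 j, (j <= m)%N & runmax k n m y = k (n + j)%N y.
Proof.
elim: m => [|m [j jm IH]]; first by exists 0%N => //; rewrite addn0.
rewrite [runmax _ _ _ _]/=; have [_|_] := leP (runmax k n m y) (k (n + m.+1)%N y).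
  by exists m.+1.
by exists j => //; exact: leqW.
Qed.

Lemma runmax_ge k n m j y : (j <= m)%N -> k (n + j)%N y <= runmax k n m y.
Proof.
elim: m => [|m IH]; first by rewrite leqn0 => /eqP ->; rewrite addn0.
rewrite leq_eqVlt => /predU1P[->|/IH h]; rewrite /= le_max ?lexx ?orbT//.
by rewrite h.
Qed.

Lemma runmax_le k n m n' m' y : (n' <= n)%N -> (n + m <= n' + m')%N ->
  runmax k n m y <= runmax k n' m' y.
Proof.
move=> nn nm; have [j jm ->] := runmax_ex k n m y.
have -> : (n + j = n' + (n + j - n'))%N by rewrite subnKC// (leq_trans nn)// leq_addr.
apply: runmax_ge; rewrite leq_subLR; apply: leq_trans nm; by rewrite leq_add2l.
Qed.

Section Fatou.
Variables (k : nat -> X -> R) (e : R).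
Hypothesis cX : compact [set: X].
Hypothesis ck : forall n, continuous (k n).
Hypothesis rk : forall n, nonneg_le (k n).
Hypothesis e0 : 0 < e.
Hypothesis ke : forall n, e <= posvar (k n).

Let runmax_cont n m : continuous (runmax k n m).
Proof.
elim: m => [|m IH] /=; first exact: ck.
by move=> y; apply: continuous_max; [exact: IH|exact: ck].
Qed.

Let runmax_range n m : nonneg_le (runmax k n m).
Proof. by move=> y; have [j _ ->] := runmax_ex k n m y; exact: rk. Qed.

Let range0 g : nonneg_le g -> forall y, 0 <= g y.
Proof. by move=> rg y; case/andP: (rg y). Qed.

Let rangeB g : nonneg_le g -> forall y, g y <= B.
Proof. by move=> rg y; case/andP: (rg y). Qed.

Let a n := sup (range (fun m => posvar (runmax k n m))).

Let a_has_sup n : has_sup (range (fun m => posvar (runmax k n m))).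
Proof.
split; first by exists (posvar (runmax k n 0)), 0%N.
exists (C * B) => _ [m _ <-]; apply: posvar_bound.
  exact: range0.
exact: rangeB.
Qed.

Let posvar_le_a n g m : nonneg_le g -> (forall y, g y <= runmax k n m y) ->
  posvar g <= a n.
Proof.
move=> rg gm; apply: (@le_trans _ _ (posvar (runmax k n m))).
  by apply: (@posvar_mono _ _ B) => //; [exact: range0|exact: rangeB].
by apply: sup_upper_bound; [exact: a_has_sup|exists m].
Qed.

(** Fatou's lemma without measures. Let [a n] be the supremum of [posvar] over the
finite maxima of [k n, k n.+1, ...], and let [G n] be one of these maxima that
nearly attains it. By submodularity, the variation of the minimum [H n] of
[G 0, ..., G n] stays above [a n] minus a partial sum of a geometric series,
hence above [e / 2]. So the decreasing functions [H n] have a common point where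
all of them are large, and there infinitely many [k n] are large. *)
Lemma posvar_limsup :
  exists y, forall N, exists2 n, (N <= n)%N & e / (2 * (C + 1)) <= k n y.
Proof.
have half_gt0 n : 0 < e / 2 / 2 ^+ n.+1 by rewrite divr_gt0// ?divr_gt0// exprn_gt0.
have /choice[m mP] n : exists m, a n - e / 2 / 2 ^+ n.+1 < posvar (runmax k n m).
  have [_ [m _ <-] h] := sup_adherent (half_gt0 n) (a_has_sup n).
  by exists m.
pose G n := runmax k n (m n).
pose fix H n := if n is n'.+1 then H n' \min G n else G 0%N.
have cH n : continuous (H n).
  elim: n => [|n IH]; first exact: runmax_cont.
  by move=> y; apply: continuous_min; [exact: IH|exact: runmax_cont].
have rH n : nonneg_le (H n).
  elim: n => [|n IH]; first exact: runmax_range.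
  move=> y; rewrite /= le_min; have /andP[-> hB] := IH y.
  by have /andP[-> _] := runmax_range n.+1 (m n.+1) y; rewrite ge_min hB.
have HG n y : H n y <= G n y.
  by case: n => [|n] //=; rewrite ge_min lexx orbT.
have Hdec i n y : (i <= n)%N -> H n y <= H i y.
  elim: n => [|n IH]; first by rewrite leqn0 => /eqP ->.
  rewrite leq_eqVlt => /predU1P[->//|]; rewrite ltnS => /IH; apply: le_trans.
  by rewrite /= ge_min lexx.
have key n : a n - e / 2 * (1 - (2 ^+ n.+1)^-1) <= posvar (H n).
  elim: n => [|n IH].
    have := mP 0%N; rewrite -/(G 0%N) expr1 => h; apply/ltW; apply: le_lt_trans h.
    by rewrite lerD2l lerN2; lra.
  have := posvar_submodular (cH n) (@runmax_cont n.+1 (m n.+1)) (rH n)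
    (@runmax_range n.+1 (m n.+1)).
  have : posvar (H n \max G n.+1) <= a n.
    have [M M1 M2] : exists2 M, (m n <= M)%N & (m n.+1 < M)%N.
      by exists (maxn (m n) (m n.+1)).+1; rewrite ?ltnS ?leqW ?leq_maxl ?leq_maxr.
    apply: (@posvar_le_a _ _ M).
      move=> y; rewrite /= le_max; have /andP[-> hB] := rH n y.
      by have /andP[_ gB] := runmax_range n.+1 (m n.+1) y; rewrite ge_max hB.
    move=> y; rewrite /= ge_max; apply/andP; split.
      apply: (le_trans (HG n y)); apply: runmax_le => //.
      by rewrite leq_add2l.
    apply: runmax_le; first exact: leqnSn.
    by rewrite addSnnS leq_add2l.
  have := mP n.+1; rewrite -/(G n.+1) -[H n \min G n.+1]/(H n.+1).
  have E : (2 ^+ n.+1)^-1 = 2 * (2 ^+ n.+2)^-1 :> R.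
    by rewrite [in RHS]exprS invfM mulrA divff// mul1r.
  move: IH; rewrite -[e / 2 / 2 ^+ n.+2]/(e / 2 * (2 ^+ n.+2)^-1) E; lra.
have Hbig n : e / 2 <= posvar (H n).
  apply: le_trans (key n).
  have : e <= a n by apply: (le_trans (ke n)); apply: (@posvar_le_a _ _ 0%N).
  have : 0 < (2 ^+ n.+1)^-1 :> R by rewrite invr_gt0 exprn_gt0.
  by move: e0; nra.
(* The bound [C * d < e / 2] says that a function below [d] everywhere has
   variation less than [e / 2]; the summand 1 allows for [C = 0]. *)
pose d := e / (2 * (C + 1)).
have Cd : C * d < e / 2.
  have C1 : 0 < 2 * (C + 1) by move: C0; lra.
  have d0 : 0 < d by rewrite divr_gt0.
  have dE : d * (2 * (C + 1)) = e by rewrite /d divfK// gt_eqF.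
  by move: dE d0; nra.
have Hpt n : exists y, d <= H n y.
  apply: contrapT => /forallNP h; have := Hbig n; apply/negP; rewrite -ltNge.
  apply: le_lt_trans Cd; apply: posvar_bound; first exact: range0.
  by move=> y; rewrite leNgt; apply/negP => /ltW/h.
have [| | | |y _ hy] :=
    @compact_directed X setT (range (fun n => [set y | d <= H n y])) cX.
- by exists [set y | d <= H 0%N y], 0%N.
- move=> _ [n _ <-].
  by apply: (@preimage_closed _ _ (H n) [set x | d <= x]) => [z _|];
    [exact: cH|exact: closed_ge].
- by move=> _ [n _ <-]; have [y hy] := Hpt n; exists y.
- move=> _ _ [i _ <-] [n _ <-]; exists [set y | d <= H (maxn i n) y].
    by exists (maxn i n).
  by move=> y /= h; split; apply: (le_trans h); apply: Hdec;
    rewrite ?leq_maxl ?leq_maxr.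
exists y => N; have /= hN := hy _ (ex_intro2 _ _ N I erefl).
have [j jm jE] := runmax_ex k N (m N) y.
by exists (N + j)%N; [exact: leq_addr|rewrite -jE; exact: le_trans hN (HG N y)].
Qed.

End Fatou.

Lemma cluster_closed (T : topologicalType) (F : set_system T) (A : set T) (x : T) :
  closed A -> F A -> cluster F x -> A x.
Proof. by move=> clA FA; rewrite clusterE => /(_ A FA)/clA. Qed.

(** Grothendieck's double limit argument. For a finite list [l] of indices let
[w l] be a point at which [k t] is at least [d] for all [t] in [l], if there is
such a point. Choose [u n] in [P], close enough to [s] to make [k (u n)] small at
[w l] for each list [l] of earlier terms. By Fatou's lemma infinitely many
[k (u i)] are at least [d] at one and the same point. For the list [l] of such
[u i] with [i < n], the point [z n = w l] therefore makes all [k t] with [t] in [l]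
large, while the later [k (u i)] are small there. So the two iterated limits of
[k (u i) (z n)] differ, which separate continuity on a product of compact sets
forbids. *)
Lemma double_limit_absurd (Y : topologicalType) (K P : set Y) (k : Y -> X -> R)
    (s : Y) (e : R) :
  compact [set: X] -> compact K -> P `<=` K -> closure P s -> 0 < e ->
  (forall t, K t -> continuous (k t)) ->
  (forall t, K t -> nonneg_le (k t)) ->
  (forall y, continuous (k^~ y)) ->
  (forall y, k s y = 0) ->
  (forall t, P t -> e <= posvar (k t)) -> False.
Proof.
move=> cX cK PK clPs e0 ck rk kc ks0 kP.
pose d := e / (2 * (C + 1)).
have d0 : 0 < d by rewrite divr_gt0// mulr_gt0// ltr_wpDl.
have [y0 _] : exists y0 : X, True.
  have [t0 [Pt0 _]] := clPs setT filterT.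
  have [y _] := @posvar_limsup (fun=> k t0) e cX (fun=> ck _ (PK _ Pt0))
    (fun=> rk _ (PK _ Pt0)) e0 (fun=> kP _ Pt0).
  by exists y.
have /choice[w wP] (l : seq Y) : exists y,
    (exists y', forall t, t \in l -> d <= k t y') ->
    forall t, t \in l -> d <= k t y.
  have [[y h]|h] := pselect (exists y', forall t, t \in l -> d <= k t y').
    by exists y.
  by exists y0.
have [u uP] : exists u : nat -> Y, forall n, P (u n) /\
    forall l, subseq l (mkseq u n) -> k (u n) (w l) < d / 2.
  apply: (@seq_choice Y (fun L t => P t /\
    forall l, subseq l L -> k t (w l) < d / 2)) => L.
  have : nbhs s [set t |
      forall m : (size L).-tuple bool, k t (w (mask m L)) < d / 2].
    apply: filter_forall => m.
    have lt0 : nbhs (k s (w (mask m L))) [set r : R | r < d / 2].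
      by apply: open_nbhs_nbhs; split; [exact: open_lt|rewrite /= ks0 divr_gt0].
    exact: (kc (w (mask m L)) s _ lt0).
  move=> /clPs[t [Pt ht]]; exists t; split=> // l /subseqP[m sm ->].
  by have := ht (@Tuple _ _ m (introT eqP sm)).
have Ku n : K (u n) by apply: PK; case: (uP n).
have [y yinf] := @posvar_limsup (k \o u) e cX (fun n => ck _ (Ku n))
  (fun n => rk _ (Ku n)) e0 (fun n => kP _ (uP n).1).
rewrite -/d /= in yinf; pose j n := d <= k (u n) y.
pose z n := w [seq u i | i <- iota 0 n & j i].
have za i n : (i < n)%N -> j i -> d <= k (u i) (z n).
  move=> ltin ji; apply: wP; first exists y.
    by move=> t /mapP[i']; rewrite mem_filter => /andP[ji' _] ->.
  by apply/mapP; exists i => //; rewrite mem_filter ji mem_iota.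
have zb i n : (n <= i)%N -> k (u i) (z n) < d / 2.
  move=> leni; have [_] := uP i; apply; apply: map_subseq.
  apply: subseq_trans (filter_subseq _ _) _.
  by rewrite -(subnKC leni) iotaD; exact: prefix_subseq.
pose F := filter_from [set: nat]
  (fun N => [set u i | i in [set i | (N <= i)%N /\ j i]]).
have FF : ProperFilter F.
  apply: filter_from_proper; last first.
    by move=> N _; have [i Ni ji] := yinf N; exists (u i), i.
  apply: filter_from_filter; first by exists 0%N.
  move=> M N _ _; exists (maxn M N) => // _ [i [+ ji] <-].
  by rewrite geq_max => /andP[Mi Ni]; split; exists i.
have FN N : F [set u i | i in [set i | (N <= i)%N /\ j i]] by exists N.
have [t [Kt clt]] : K `&` cluster F !=set0.
  by apply: cK; exists 0%N => // _ [i _ <-].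
have [x [_ clx]] : [set: X] `&` cluster (z @ \oo) !=set0.
  by apply: cX; exists 0%N.
have dx : d <= k t x.
  apply: (@cluster_closed _ F [set t | d <= k t x]) clt.
    apply: (@preimage_closed _ _ (k^~ x) [set r | d <= r]); last exact: closed_ge.
    by move=> ? _; exact: kc.
  apply: filterS (FN 0%N) => _ [i [_ ji] <-] /=.
  apply: (@cluster_closed _ _ [set x | d <= k (u i) x]) clx.
    apply: (@preimage_closed _ _ (k (u i)) [set r | d <= r]); last exact: closed_ge.
    by move=> ? _; exact: ck.
  by exists i.+1 => // n /= ltin; exact: za.
have : k t x <= d / 2.
  apply: (@cluster_closed _ _ [set x | k t x <= d / 2]) clx.
    apply: (@preimage_closed _ _ (k t) [set r | r <= d / 2]); last exact: closed_le.
    by move=> ? _; exact: ck.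
  exists 0%N => // n _ /=.
  apply: (@cluster_closed _ F [set t | k t (z n) <= d / 2]) clt.
    apply: (@preimage_closed _ _ (k^~ (z n)) [set r | r <= d / 2]);
      last exact: closed_le.
    by move=> ? _; exact: kc.
  by apply: filterS (FN n) => _ [i [ni _] <-] /=; exact/ltW/zb.
by apply/negP; rewrite -ltNge; apply: lt_le_trans dx; move: d0; lra.
Qed.

End BoundedFunctional.

(** On a compact family of continuous functions, pointwise continuity of the
parametrization implies weak continuity: if [psi (h t)] did not approach
[psi (h s)], the functions [`|h t - h s|] would contradict
[double_limit_absurd]. *)
Theorem grothendieck (R : realType) (X Y : topologicalType)
    (psi : (X -> R) -> R) (C B : R) (K : set Y) (h : Y -> X -> R) :
  (forall (a : R) (f g : X -> R), continuous f -> continuous g ->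
    psi (fun y => a * f y + g y) = a * psi f + psi g) ->
  (forall (f : X -> R) (M : R), continuous f -> (forall y, `|f y| <= M) ->
    `|psi f| <= C * M) -> 0 <= C ->
  compact [set: X] -> compact K ->
  (forall t, K t -> continuous (h t)) -> (forall y, continuous (h^~ y)) ->
  (forall t y, K t -> `|h t y| <= B) ->
  forall s e, K s -> 0 < e ->
  \forall t \near s, K t -> `|psi (h t) - psi (h s)| < e.
Proof.
move=> psi_lin psi_bd C0 cX cK ch hc hB s e Ks e0.
pose P := [set t | K t /\ e <= `|psi (h t) - psi (h s)|].
apply: contrapT => nPs.
have clPs : closure P s.
  move=> A As; apply: contrapT => nPA; apply: nPs; apply: filterS As => t At Kt.
  by rewrite ltNge; apply/negP => et; apply: nPA; exists t.
pose k t y := `|h t y - h s y|.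
apply: (@double_limit_absurd R X psi C psi_lin psi_bd C0 (2 * B) Y K P k s e) => //.
- by move=> t [].
- move=> t Kt y; apply: cvg_norm; apply: cvgB; exact: ch.
- move=> t Kt y; rewrite normr_ge0 /= (le_trans (ler_normB _ _))//.
  by have := hB _ y Kt; have := hB _ y Ks; lra.
- by move=> y t; apply: cvg_norm; apply: cvgB; [exact: hc|exact: cvg_cst].
- by move=> y; rewrite /k subrr normr0.
move=> t [Kt et].
have cd : continuous (fun y => (-1) * h s y + h t y).
  by move=> y; apply: cvgD; [apply: cvgM; [exact: cvg_cst|exact: ch]|exact: ch].
have cd' : continuous (fun y => (-1) * h t y + h s y).
  by move=> y; apply: cvgD; [apply: cvgM; [exact: cvg_cst|exact: ch]|exact: ch].
have kB y : k t y <= 2 * B.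
  rewrite (le_trans (ler_normB _ _))//.
  by have := hB _ y Kt; have := hB _ y Ks; lra.
have p1 := posvar_ge psi_bd kB cd; have p2 := posvar_ge psi_bd kB cd'.
rewrite !psi_lin// in p1 p2; try exact: ch.
move: et; rewrite ler_normr => /orP[et|et].
  apply: (le_trans et); apply: le_trans (p1 _); first by lra.
  by move=> y; rewrite /k mulN1r addrC.
apply: (le_trans et); apply: le_trans (p2 _); first by lra.
by move=> y; rewrite /k mulN1r addrC distrC.
Qed.

(** * Self-maps of a space under pointwise convergence *)

Lemma closure_sub (T : topologicalType) (A B : set T) :
  closed B -> A `<=` B -> closure A `<=` B.
Proof. by move=> clB /closure_subset AB x /AB; rewrite -(closure_id B).1. Qed.

Section PointwiseSemigroup.
Variable X : topologicalType.
Local Notation Y := {ptws X -> X}.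

Definition pcomp (f g : Y) : Y := fun x => f (g x).

Lemma pcompA : associative pcomp.
Proof. by []. Qed.

Lemma ev_continuous (x : X) : continuous (fun t : Y => t x).
Proof. exact: (@proj_continuous X (fun=> X) x). Qed.

Lemma cvg_initial (S : choiceType) (T : topologicalType) (f : S -> T)
    (F : set_system S) (s : S) :
  Filter F -> f @ F --> f s -> F --> (s : initial_topology f).
Proof.
move=> FF fF A [_ [[B oB <-] Bs BA]]; apply: filterS BA _; apply: fF.
exact: open_nbhs_nbhs.
Qed.

Lemma ptws_continuous (T : topologicalType) (g : T -> Y) :
  (forall x, continuous (fun t => g t x)) -> continuous g.
Proof.
move=> cg t; apply/cvg_sup => x; apply: cvg_initial; exact: cg.
Qed.

Lemma pcomp_continuousr (a : Y) : continuous (pcomp^~ a).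
Proof. by apply: ptws_continuous => x; exact: ev_continuous. Qed.

Lemma pcomp_continuousl (a : Y) : continuous (a : X -> X) -> continuous (pcomp a).
Proof.
move=> ca; apply: ptws_continuous => x t; apply: continuous_comp.
  exact: ev_continuous.
exact: ca.
Qed.

(** Composition is continuous in its left factor, and in its right factor if the
left one is a continuous map; so one factor is passed to the limit at a time. *)
Lemma closure_pcomp (T : set Y) :
  (forall s t, T s -> T t -> T (pcomp s t)) ->
  (forall s, T s -> continuous (s : X -> X)) ->
  forall s t, closure T s -> closure T t -> closure T (pcomp s t).
Proof.
move=> TT cT.
have h1 s t : T s -> closure T t -> closure T (pcomp s t).
  move=> Ts; have cl : closed (pcomp s @^-1` closure T).
    apply: preimage_closed; last exact: closed_closure.
    by move=> ? _; apply: pcomp_continuousl; exact: cT.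
  apply: (closure_sub cl) => u Tu; apply: subset_closure; exact: TT.
move=> s t + clt; have cl : closed (pcomp^~ t @^-1` closure T).
  apply: preimage_closed; last exact: closed_closure.
  by move=> ? _; exact: pcomp_continuousr.
by apply: (closure_sub cl) => u Tu; exact: h1.
Qed.

Lemma ptws_hausdorff : hausdorff_space X -> hausdorff_space Y.
Proof. by move=> hX; exact: (@hausdorff_product X (fun=> X)). Qed.

Lemma ptws_compact : compact [set: X] -> compact [set: Y].
Proof.
move=> cX; have := @tychonoff X (fun=> X) (fun=> [set: X]) (fun=> cX).
by congr compact; apply/seteqP; split.
Qed.

End PointwiseSemigroup.

(** * Continuity for the weak topology, and norm separable subsets *)

Section WeakTopology.
Variables (R : realType) (V : lmodType R) (N : V -> R).
Hypothesis N_sub : sublinear N.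
Hypothesis NN : forall v, N (- v) = N v.

Definition linear_below (phi : V -> R) :=
  (forall a x y, phi (a *: x + y) = a * phi x + phi y) /\ forall v, phi v <= N v.

(** Only real-linear functionals occur here, so that weak topologies over the real
and over the complex numbers fall under the same notion. *)
Definition weakly_continuous (T : topologicalType) (f : T -> V) :=
  forall phi, linear_below phi -> continuous (fun t => phi (f t)).

Lemma seminorm_ge0 v : 0 <= N v.
Proof. by have := sublinear_lbound v N_sub; rewrite NN; lra. Qed.

Lemma seminormD v w : N (v + w) <= N v + N w.
Proof. by case: N_sub. Qed.

Lemma seminorm_triangle u v w : N (u - w) <= N (u - v) + N (v - w).
Proof. by rewrite (_ : u - w = (u - v) + (v - w)) ?seminormD// addrA subrK. Qed.

Lemma seminorm_distC v w : N (v - w) = N (w - v).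
Proof. by rewrite -NN opprB. Qed.

Lemma linear_belowB phi u v : linear_below phi -> phi (u - v) = phi u - phi v.
Proof. by move=> [pl _]; rewrite addrC -scaleN1r pl mulN1r addrC. Qed.

(** By the Hahn-Banach theorem a sublinear functional is the maximum of the linear
functionals below it, so its sublevel sets are intersections of weakly closed
half spaces. *)
Lemma closed_sublevel (T : topologicalType) (f : T -> V) q r :
  weakly_continuous f -> sublinear q -> (forall v, q v <= N v) ->
  closed [set t | q (f t) <= r].
Proof.
move=> cf sq qN.
pose D := [set phi | linear_below phi /\ forall v, phi v <= q v].
have -> : [set t | q (f t) <= r] =
    \bigcap_(phi in D) ((fun t => phi (f t)) @^-1` [set x | x <= r]).
  apply/seteqP; split=> [t /= qr phi [_ phiq]|t /= h].
    exact: le_trans (phiq _) qr.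
  have [phi [pl pq <-]] := hahn_banach (f t) sq; apply: h; split=> //.
  by split=> // v; exact: le_trans (pq v) (qN v).
apply: closed_bigI => phi [lphi _]; apply: preimage_closed; last exact: closed_le.
by move=> t _; exact: cf.
Qed.

Lemma weakly_continuousB (T : topologicalType) (f g : T -> V) :
  weakly_continuous f -> weakly_continuous g ->
  weakly_continuous (fun t => f t - g t).
Proof.
move=> cf cg phi lphi t.
rewrite (_ : (fun t => _) = (fun t => phi (f t) - phi (g t))).
  by apply: cvgB; [exact: cf|exact: cg].
by apply/funext => s; rewrite linear_belowB.
Qed.

Lemma weakly_continuous_cst (T : topologicalType) v :
  weakly_continuous (fun _ : T => v).
Proof. by move=> phi _ t; exact: cvg_cst. Qed.

Lemma weakly_continuous_hausdorff (T : topologicalType) (f : T -> V) :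
  (forall v, N v = 0 -> v = 0) ->
  injective f -> weakly_continuous f -> hausdorff_space T.
Proof.
move=> N0 injf cf x y clxy; apply: contrapT => /eqP nxy.
have [phi [pl pN pE]] := hahn_banach (f x - f y) N_sub.
have lphi : linear_below phi by [].
have : phi (f x) = phi (f y).
  apply: (@norm_hausdorff _ R^o) => A B Ax By.
  have [z [Az Bz]] := clxy _ _ (cf _ lphi x _ Ax) (cf _ lphi y _ By).
  by exists (phi (f z)).
move/eqP; rewrite -subr_eq0 -(linear_belowB _ _ lphi) pE => /eqP/N0/eqP.
by rewrite subr_eq0 => /eqP/injf/eqP; exact/negP.
Qed.

Section RationalSpan.
Variable D : nat -> V.

Definition ratcomb (l : seq (rat * nat)) : V := \sum_(p <- l) ratr p.1 *: D p.2.

(** The distance to the rational span of the sequence [D], which is also the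
distance to the closed real span; rational coefficients make the approximating
vectors countable. *)
Definition span_dist (v : V) : R := inf (range (fun l => N (v - ratcomb l))).

Lemma span_dist_has_inf v : has_inf (range (fun l => N (v - ratcomb l))).
Proof.
split; first by exists (N (v - ratcomb [::])), [::].
by exists 0 => _ [l _ <-]; exact: seminorm_ge0.
Qed.

Lemma span_dist_le v l : span_dist v <= N (v - ratcomb l).
Proof. by apply: ge_inf; [exact: (span_dist_has_inf v).2|exists l]. Qed.

Lemma span_dist_leN v : span_dist v <= N v.
Proof. by have := span_dist_le v [::]; rewrite /ratcomb big_nil subr0. Qed.

Lemma span_dist_ge0 v : 0 <= span_dist v.
Proof.
apply: lb_le_inf; first exact: (span_dist_has_inf v).1.
by move=> _ [l _ <-]; exact: seminorm_ge0.
Qed.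

Lemma span_dist_gen n : span_dist (D n) <= 0.
Proof.
have := span_dist_le (D n) [:: (1, n)].
by rewrite /ratcomb big_seq1/= rmorph1 scale1r subrr sublinear0.
Qed.

Lemma span_dist_lt v e : span_dist v < e -> exists l, N (v - ratcomb l) < e.
Proof.
move=> h; have [_ [l _ <-] hl] := inf_lt (span_dist_has_inf v).1 h.
by exists l.
Qed.

Lemma ratcombD l l' : ratcomb (l ++ l') = ratcomb l + ratcomb l'.
Proof. by rewrite /ratcomb big_cat. Qed.

Lemma ratcombZ (r : rat) l :
  ratcomb [seq (r * p.1, p.2) | p <- l] = ratr r *: ratcomb l.
Proof.
rewrite /ratcomb big_map scaler_sumr; apply: eq_bigr => p _ /=.
by rewrite rmorphM scalerA.
Qed.

(** For homogeneity under a real factor [t], an approximating combination is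
multiplied by a rational number slightly larger than [t]. *)
Lemma span_dist_sublinear : sublinear span_dist.
Proof.
have [_ Nh] := N_sub.
have qZ t x : 0 < t -> span_dist (t *: x) <= t * span_dist x.
  move=> t0; apply/ler_addgt0Pr => e e0.
  have [|l hl] := @span_dist_lt x (span_dist x + e / 2 / t).
    by rewrite ltrDl !divr_gt0.
  pose M := N (ratcomb l) + 1.
  have M0 : 0 < M by rewrite ltr_wpDl// seminorm_ge0.
  have tM : t < t + e / 2 / M by rewrite ltrDl !divr_gt0.
  have [r] := rat_in_itvoo tM; rewrite in_itv/= => /andP[tr rt].
  apply: (le_trans (span_dist_le _ [seq (r * p.1, p.2) | p <- l])).
  rewrite ratcombZ (_ : _ - _ = t *: (x - ratcomb l) - (ratr r - t) *: ratcomb l).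
    apply: (le_trans (seminormD _ _)).
    rewrite NN !Nh ?(ltW t0)//; last by rewrite subr_ge0 ltW.
    have h1 : t * N (x - ratcomb l) <= t * span_dist x + e / 2.
      rewrite (_ : _ + _ = t * (span_dist x + e / 2 / t)); last first.
        by field; rewrite gt_eqF.
      by rewrite ler_pM2l// ltW.
    have h2 : (ratr r - t) * N (ratcomb l) <= e / 2.
      apply: (@le_trans _ _ ((ratr r - t) * M)).
        by rewrite ler_wpM2l ?subr_ge0 ?(ltW tr)// lerDl.
      by rewrite -ler_pdivlMr// lerBlDl ltW.
    lra.
  by rewrite scalerBr scalerBl opprB addrA addrNK.
split.
  move=> x y; apply/ler_addgt0Pr => e e0.
  have [|l hl] := @span_dist_lt x (span_dist x + e / 2).
    by rewrite ltrDl divr_gt0.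
  have [|l' hl'] := @span_dist_lt y (span_dist y + e / 2).
    by rewrite ltrDl divr_gt0.
  apply: (le_trans (span_dist_le _ (l ++ l'))); rewrite ratcombD opprD addrACA.
  by apply: (le_trans (seminormD _ _)); lra.
move=> t x; rewrite le_eqVlt => /predU1P[<-|t0].
  rewrite scale0r mul0r; apply/eqP; rewrite eq_le span_dist_ge0 andbT.
  by apply: (le_trans (span_dist_leN _)); rewrite sublinear0.
apply/eqP; rewrite eq_le qZ//=.
have ti0 : 0 < t^-1 by rewrite invr_gt0.
have := qZ t^-1 (t *: x) ti0.
by rewrite scalerA mulVf ?gt_eqF// scale1r ler_pdivlMl.
Qed.

End RationalSpan.

End WeakTopology.

(** * Invariant means concentrated on an orbit *)

(** The functional [psi] stands for an invariant mean on C(X) that comes from the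
orbit of [x]. As it is a total function, every property mentions continuity. *)
Definition orbit_mean (R : realType) (X : topologicalType)
    (T : set {ptws X -> X}) (x : X) (psi : (X -> R) -> R) :=
  [/\ forall (a : R) (f g : X -> R), continuous f -> continuous g ->
        psi (fun y => a * f y + g y) = a * psi f + psi g,
      psi (cst 1) = 1,
      forall f : X -> R, continuous f -> (forall y, 0 <= f y) -> 0 <= psi f,
      forall (f : X -> R) t, continuous f -> T t -> psi (f \o t) = psi f &
      forall f : X -> R, continuous f -> (forall t, T t -> f (t x) = 0) ->
        psi f = 0].

Definition invariant (X : Type) (T : set (X -> X)) (F : set X) :=
  forall t y, T t -> F y -> F (t y).

Section Dynamics.
Variables (R : realType) (X : topologicalType) (T : set {ptws X -> X}).
Hypothesis hX : hausdorff_space X.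
Hypothesis cX : compact [set: X].
Hypothesis Tcomp : forall s t, T s -> T t -> T (pcomp s t).
Hypothesis T1 : T id.
Hypothesis Tcont : forall t, closure T t -> continuous (t : X -> X).

Local Notation Sigma := (closure T).

Lemma T_continuous t : T t -> continuous (t : X -> X).
Proof. by move=> Tt; apply: Tcont; exact: subset_closure. Qed.

Lemma Sigma_compact (G : set {ptws X -> X}) : closed G -> compact G.
Proof.
move=> clG; apply: (subclosed_compact clG (ptws_compact cX)).
exact: subsetT.
Qed.

Lemma invariant_closure (G : set {ptws X -> X}) F :
  closed F -> invariant G F -> invariant (closure G) F.
Proof.
move=> clF GF t y clt Fy.
have cl : closed [set s : {ptws X -> X} | F (s y)].
  by apply: (@preimage_closed _ _ (fun s : {ptws X -> X} => s y)) => // s _;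
    exact: ev_continuous.
by apply: (closure_sub cl _ clt) => s Gs; exact: GF.
Qed.

Lemma separating_function (A : set X) (y : X) : closed A -> ~ A y ->
  exists f : X -> R, [/\ continuous f, forall z, 0 <= f z,
    forall z, A z -> f z = 0 & f y = 1].
Proof.
move=> clA Ay; have nX := compact_normal hX cX.
have us : uniform_separator A [set y].
  apply: ((@normal_separatorP R X).1 nX) => //.
    exact: accessible_closed_set1 (hausdorff_accessible hX) _.
  by apply/seteqP; split=> // z [Az zy]; apply: Ay; rewrite -zy.
exists (Urysohn A [set y] : X -> R); split.
- exact: Urysohn_continuous.
- move=> z; have : `[0, 1]%classic (Urysohn A [set y] z : R).
    by apply: Urysohn_range; exists z.
  by rewrite /= in_itv/= => /andP[].
- by move=> z Az; apply: (Urysohn_sub0 us); exists z.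
- by apply: (Urysohn_sub1 us); exists y.
Qed.

Section Mean.
Variables (x : X) (psi : (X -> R) -> R).
Hypothesis psiM : orbit_mean T x psi.

Lemma mean_bounded (f : X -> R) M : continuous f -> (forall y, `|f y| <= M) ->
  `|psi f| <= 1 * M.
Proof.
have [psil psi1 psi0 _ _] := psiM; move=> cf fM.
have c1 (c : R) : continuous (fun _ : X => c) by move=> ?; exact: cvg_cst.
have psic (c : R) : psi (fun=> c) = c.
  have E : (c - 1) * psi (cst 1) + psi (cst 1) = c by rewrite psi1 mulr1 subrK.
  apply: etrans E; rewrite -psil; [|exact: c1|exact: c1].
  by congr psi; apply/funext => z; rewrite /= mulr1 subrK.
have cB (a : R) : continuous (fun y => a * f y + M).
  move=> y; apply: cvgD; last exact: cvg_cst.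
  by apply: cvgM; [exact: cvg_cst|exact: cf].
have h1 := psi0 _ (cB 1) _; have h2 := psi0 _ (cB (-1)) _.
rewrite !(psil _ f (fun=> M))// !psic in h1 h2.
rewrite ler_norml mul1r; apply/andP; split.
  by move: h1; rewrite mul1r => h1; rewrite -subr_ge0 opprK; apply: h1 => y;
    have := fM y; rewrite ler_norml => /andP[]; lra.
by move: h2; rewrite mulN1r addrC subr_ge0; apply=> y;
    have := fM y; rewrite ler_norml => /andP[]; lra.
Qed.

(** By Grothendieck's theorem [psi (f \o t)] depends continuously on [t] in the
closure of [T], and it is constant on [T]. *)
Lemma mean_invariant (f : X -> R) s :
  continuous f -> Sigma s -> psi (f \o s) = psi f.
Proof.
move=> cf clTs; have [psil psi1 psi0 psiI _] := psiM.
have [M fM] := continuous_bounded x cX cf.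
apply/eqP; rewrite -subr_eq0 -normr_le0.
apply/ler_addgt0Pr => e e0; rewrite add0r.
have cfs t : Sigma t -> continuous (f \o t).
  by move=> /Tcont ct y; apply: continuous_comp; [exact: ct|exact: cf].
have nears : \forall t \near s, Sigma t -> `|psi (f \o t) - psi (f \o s)| < e.
  apply: (@grothendieck R X {ptws X -> X} psi 1 M Sigma (fun t => f \o t)) => //.
  - exact: mean_bounded.
  - by apply: Sigma_compact; exact: closed_closure.
  - move=> y t; apply: (@continuous_comp _ _ _ (fun t : {ptws X -> X} => t y)).
      exact: ev_continuous.
    exact: cf.
  - by move=> t y _; exact: fM.
have [t [Tt ht]] := clTs _ nears.
by have := ht (subset_closure Tt); rewrite psiI// distrC => /ltW.
Qed.

End Mean.

Section Minimal.
Variables (F : set X) (x0 : X).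
Hypothesis clF : closed F.
Hypothesis Fx0 : F x0.
Hypothesis FT : invariant T F.
Hypothesis Fmin : forall A,
  A `<=` F -> closed A -> A !=set0 -> invariant T A -> A = F.
Variable psi : (X -> R) -> R.
Hypothesis psiM : orbit_mean T x0 psi.

Let FS : invariant Sigma F := invariant_closure clF FT.

(** The support of [psi]. *)
Let Z := [set y | forall f : X -> R, continuous f -> (forall z, 0 <= f z) ->
  psi f = 0 -> f y = 0].

(** The support is closed, invariant and contained in every closed set that
contains the orbit. It is nonempty, since otherwise compactness would yield
a function positive everywhere, hence bounded below by a positive constant, on
which [psi] vanishes. *)
Lemma support_full : Z = F.
Proof.
have [psil psi1 psi0 psiI psiO] := psiM.
have clker (f : X -> R) : continuous f -> closed [set y | f y = 0].
  move=> cf; apply: (@preimage_closed _ _ f [set 0]) => [y _|]; first exact: cf.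
  exact: closed_eq.
apply: Fmin.
- move=> y Zy; apply: contrapT => nFy.
  have [f [cf f0 fF fy]] := separating_function clF nFy.
  have /eqP : f y = 0.
    apply: Zy => //; apply: psiO => // t Tt; apply: fF; exact: FT.
  by rewrite fy oner_eq0.
- have -> : Z = \bigcap_(f in [set f : X -> R | [/\ continuous f,
      forall z, 0 <= f z & psi f = 0]]) [set y | f y = 0].
    apply/seteqP; split=> [y Zy f [cf f0 pf]|y Zy f cf f0 pf]; first exact: Zy.
    by apply: (Zy f).
  by apply: closed_bigI => f [cf _ _]; exact: clker.
- pose Cs := [set A | exists f : X -> R, [/\ continuous f, forall z, 0 <= f z,
     psi f = 0 & A = [set y | f y = 0]]].
  have [| | | |y _ hy] := @compact_directed X setT Cs cX.
  + exists [set y | cst (0 : R) y = 0], (cst 0); split=> //.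
      by move=> y; exact: cvg_cst.
    by apply: psiO => // y; exact: cvg_cst.
  + by move=> _ [f [cf _ _ ->]]; exact: clker.
  + move=> _ [f [cf f0 pf ->]]; apply: contrapT => nf.
    have fpos y : 0 < f y.
      rewrite lt_neqAle f0 andbT; apply/eqP => fy; apply: nf; exists y; split => //.
    have [c _ hc] : exists2 c, c \in [set: X] &
        forall t, t \in [set: X] -> f c <= f t.
      apply: compact_EVT_min => //; first by exists x0.
      exact: continuous_subspaceT.
    have cc : continuous (cst (- f c) : X -> R) by move=> y; exact: cvg_cst.
    have c1 : continuous (cst 1 : X -> R) by move=> y; exact: cvg_cst.
    suff : 0 <= psi (fun y => (- f c) * cst 1 y + f y).
      by rewrite psil// psi1 pf addr0 mulr1 oppr_ge0 leNgt fpos.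
    apply: psi0 => y.
      apply: cvgD; last exact: cf.
      by apply: cvgM; exact: cvg_cst.
    by rewrite /= mulr1 addrC subr_ge0; apply: hc; rewrite inE.
  + move=> _ _ [f [cf f0 pf ->]] [g [cg g0 pg ->]].
    exists [set y | 1 * f y + g y = 0].
      exists (fun y => 1 * f y + g y); split => //.
      * move=> y; apply: cvgD; last exact: cg.
        by apply: cvgM; [exact: cvg_cst|exact: cf].
      * by move=> y; rewrite mul1r addr_ge0.
      * by rewrite psil// pf pg mulr0 addr0.
    by move=> y /=; rewrite mul1r => /eqP; rewrite paddr_eq0// => /andP[/eqP ? /eqP].
  exists y => f cf f0 pf; apply: (hy [set y | f y = 0]); by exists f.
- move=> t y Tt Zy f cf f0 pf.
  have : (f \o t) y = 0; last by [].
  apply: Zy => [z|z|]; [|exact: f0|by rewrite psiI].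
  by apply: continuous_comp; [exact: T_continuous|exact: cf].
Qed.

(** A point of [F] outside the image of [F] under [s] is detected by a function
[f >= 0] that vanishes on this image. Then [psi f = psi (f \o s) = 0], as [f \o s]
vanishes on the orbit, although the support of [psi] is all of [F]. *)
Lemma Sigma_surjective s y : Sigma s -> F y -> exists2 z, F z & s z = y.
Proof.
have [psil psi1 psi0 psiI psiO] := psiM.
move=> clTs Fy; apply: contrapT => h.
have clsF : closed [set s z | z in F].
  apply: compact_closed => //; apply: continuous_compact.
    by apply: continuous_subspaceT; exact: Tcont.
  exact: (subclosed_compact clF cX).
have [|f [cf f0 fF fy]] := @separating_function [set s z | z in F] y clsF.
  by move=> [z Fz zy]; apply: h; exists z.
have /eqP : f y = 0; last by rewrite fy oner_eq0.
move: Fy; rewrite -support_full => /(_ f); apply => //.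
rewrite -(mean_invariant psiM cf clTs); apply: psiO => [z|t Tt].
  by apply: continuous_comp; [exact: Tcont|exact: cf].
by apply: fF; exists (t x0) => //; exact: FT.
Qed.

(** An idempotent fixes its image, and here its image contains [F]. *)
Lemma identity_in_subsemigroup (G : set {ptws X -> X}) :
  G `<=` Sigma -> closed G -> G !=set0 ->
  (forall s t, G s -> G t -> G (pcomp s t)) ->
  exists2 e, G e & forall y, F y -> e y = y.
Proof.
move=> GS clG G0 GG.
have [e Ge ee] := idempotent_exists (ptws_hausdorff hX) (@pcompA X)
  (@pcomp_continuousr X) (Sigma_compact clG) G0 GG.
exists e => // y Fy; have [z Fz <-] := Sigma_surjective (GS _ Ge) Fy.
exact: (congr1 (fun f : {ptws X -> X} => f z) ee).
Qed.

(** The maps [pcomp h g] with [h] in [G] form a closed subsemigroup, which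
therefore contains a map that is the identity on [F]. *)
Lemma left_inverse (G : set {ptws X -> X}) g :
  G `<=` Sigma -> closed G -> (forall s t, G s -> G t -> G (pcomp s t)) ->
  G g -> exists2 h, G h & forall y, F y -> h (g y) = y.
Proof.
move=> GS clG GG Gg.
have [| | | |e [h Gh <-] he] :=
    @identity_in_subsemigroup [set pcomp h g | h in G].
- by move=> _ [h Gh <-]; apply: GS; exact: GG.
- apply: compact_closed; first exact: ptws_hausdorff.
  apply: continuous_compact; last exact: Sigma_compact.
  by apply: continuous_subspaceT; exact: pcomp_continuousr.
- by exists (pcomp g g), g.
- move=> _ _ [a Ga <-] [b Gb <-]; exists (pcomp (pcomp a g) b) => //.
  by apply: (GG _ _ _ Gb); exact: GG.
by exists h.
Qed.

Lemma Sigma_transitive y : F y -> exists2 s, Sigma s & s x0 = y.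
Proof.
have SF : [set s x0 | s in Sigma] = F.
  apply: Fmin.
  - by move=> _ [s Ss <-]; exact: FS.
  - apply: compact_closed => //; apply: continuous_compact.
      by apply: continuous_subspaceT; exact: ev_continuous.
    by apply: Sigma_compact; exact: closed_closure.
  - by exists (id x0), id => //; exact: subset_closure.
  - move=> t _ Tt [s Ss <-]; exists (pcomp t s) => //.
    apply: closure_pcomp => //; last exact: subset_closure.
    exact: T_continuous.
by rewrite -{1}SF => -[s Ss <-]; exists s.
Qed.

End Minimal.

End Dynamics.

(** * Nonexpansive actions that carry orbit means *)

Section FixedPoint.
Variables (R : realType) (V : lmodType R) (N : V -> R).
Hypothesis N_sub : sublinear N.
Hypothesis NN : forall v, N (- v) = N v.
Hypothesis N0 : forall v, N v = 0 -> v = 0.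
Variables (X : topologicalType) (iota : X -> V).
Hypothesis iota_inj : injective iota.
Hypothesis iota_cont : weakly_continuous N iota.
Hypothesis cX : compact [set: X].
Variable T : set {ptws X -> X}.
Hypothesis Tcomp : forall s t, T s -> T t -> T (pcomp s t).
Hypothesis T1 : T id.
Hypothesis Tcont : forall t, closure T t -> continuous (t : X -> X).
Hypothesis Tnonexp : forall t x y, T t ->
  N (iota (t x) - iota (t y)) <= N (iota x - iota y).

Let hX : hausdorff_space X :=
  weakly_continuous_hausdorff N_sub N0 iota_inj iota_cont.

Let iota_ev x : weakly_continuous N (fun t : {ptws X -> X} => iota (t x)).
Proof.
move=> phi lphi t; apply: (@continuous_comp _ _ _ (fun t : {ptws X -> X} => t x)
  (fun x => phi (iota x))); first exact: ev_continuous.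
exact: iota_cont.
Qed.

Lemma closure_nonexpansive t x y : closure T t ->
  N (iota (t x) - iota (t y)) <= N (iota x - iota y).
Proof.
have cl : closed [set t : {ptws X -> X} |
    N (iota (t x) - iota (t y)) <= N (iota x - iota y)].
  apply: (@closed_sublevel R V N {ptws X -> X}
    (fun t => iota (t x) - iota (t y)) N) => //.
  by apply: weakly_continuousB; exact: iota_ev.
by move/(closure_sub cl); apply=> s Ts; exact: Tnonexp.
Qed.

Lemma closed_iota_ball v r : closed [set x | N (iota x - v) <= r].
Proof.
apply: (@closed_sublevel R V N _ (fun x => iota x - v) N) => //.
by apply: weakly_continuousB => //; exact: weakly_continuous_cst.
Qed.

Section Minimal.
Variables (F : set X) (x0 : X).
Hypothesis clF : closed F.
Hypothesis Fx0 : F x0.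
Hypothesis FT : invariant T F.
Hypothesis Fmin : forall A,
  A `<=` F -> closed A -> A !=set0 -> invariant T A -> A = F.
Variable psi : (X -> R) -> R.
Hypothesis psiM : orbit_mean T x0 psi.

(** Otherwise there is a sequence [u] in [F] whose terms are [e] apart. Each [u n]
is the image of [x0] under some [s n] in the closure of [T]; let [G] be the
closure of the countable semigroup of words in the [s n]. The set [F0] of images
of [x0] under [G] is weakly compact and lies within the closed span of a
countable set, so the Baire theorem gives a weakly open set [U] whose
intersection with [F0] is nonempty and contained in a ball of radius [e / 3]. A
cluster point [y] of [u] is mapped into [U] by some [k] in [G], because [G] acts
on [F0] like a transitive group. Then [k] maps two terms of [u] into [U], and
since [k] is isometric on [F] these terms are less than [e] apart. *)
Lemma minimal_totally_bounded e : 0 < e -> exists l : seq X,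
  (forall z, z \in l -> F z) /\
  forall y, F y -> exists2 z, z \in l & N (iota y - iota z) < e.
Proof.
move=> e0; apply: contrapT => nl.
have [u uP] : exists u : nat -> X, forall n, F (u n) /\
    forall z, z \in mkseq u n -> F z -> e <= N (iota (u n) - iota z).
  apply: (@seq_choice X (fun l x => F x /\
    forall z, z \in l -> F z -> e <= N (iota x - iota z))) => l.
  apply: contrapT => h; apply: nl; exists [seq z <- l | `[< F z >]]; split.
    by move=> z; rewrite mem_filter => /andP[/asboolP].
  move=> y Fy; apply: contrapT => h'; apply: h; exists y; split=> // z zl Fz.
  rewrite leNgt; apply/negP => lt; apply: h'; exists z => //.
  by rewrite mem_filter zl andbT; exact/asboolP.
have Fu n : F (u n) by case: (uP n).
have usep m n : (m < n)%N -> e <= N (iota (u n) - iota (u m)).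
  move=> mn; have [_] := uP n; apply=> //.
  by apply/mapP; exists m => //; rewrite mem_iota.
have /choice[s sP] n : exists s : {ptws X -> X}, closure T s /\ s x0 = u n.
  have [s Ss sx] := @Sigma_transitive X T hX cX Tcomp T1 Tcont F x0 clF Fx0 FT
    Fmin (u n) (Fu n).
  by exists s.
pose word (l : seq nat) : {ptws X -> X} := foldr (fun n f => pcomp (s n) f) id l.
have word_cat l l' : word (l ++ l') = pcomp (word l) (word l').
  by elim: l => //= n l ->.
have SS := closure_pcomp Tcomp (T_continuous Tcont).
have wordS l : closure T (word l).
  elim: l => [|n l IH] /=; first exact: subset_closure.
  by apply: SS => //; case: (sP n).
pose G := closure (range word).
have GS : G `<=` closure T.
  by apply: closure_sub; [exact: closed_closure|move=> _ [l _ <-]; exact: wordS].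
have GG f g : G f -> G g -> G (pcomp f g).
  apply: closure_pcomp => [_ _ [l _ <-] [l' _ <-]|_ [l _ <-]].
    by exists (l ++ l').
  exact/Tcont/wordS.
have clG : closed G by exact: closed_closure.
have Gs n : G (s n).
  by apply: subset_closure; exists [:: n].
pose F0 := [set g x0 | g in G].
have F0F : F0 `<=` F.
  by move=> _ [g Gg <-]; apply: (invariant_closure clF FT) => //; exact: GS.
have clF0 : closed F0.
  apply: compact_closed => //; apply: continuous_compact.
    by apply: continuous_subspaceT; exact: ev_continuous.
  exact: Sigma_compact.
(* An enumeration of the countable orbit, padded with zeros at the numbers that
   code no word. *)
pose D n := if @unpickle (seq nat) n is Some l then iota (word l x0) else 0.
have F0D x : F0 x -> span_dist N D (iota x) <= 0.
  move=> [g + <-]; have cl : closed [set g : {ptws X -> X} |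
      span_dist N D (iota (g x0)) <= 0].
    apply: (@closed_sublevel R V N {ptws X -> X} (fun g => iota (g x0))).
    - exact: iota_ev.
    - exact: span_dist_sublinear.
    - by move=> v; exact: span_dist_leN.
  move/(closure_sub cl); apply=> _ [l _ <-] /=.
  have -> : iota (word l x0) = D (pickle l) by rewrite /D pickleK.
  exact: span_dist_gen.
pose B n : set X := if @unpickle (seq (rat * nat)) n is Some l then
  [set x | N (iota x - ratcomb D l) <= e / 3] else set0.
have [| | |n [U [oU [z [F0z Uz]] UB]]] := @compact_baire X F0 B hX cX clF0.
- by exists x0, (word [::]) => //; apply: subset_closure; exists [::].
- move=> n; rewrite /B.
  by case: unpickle => [l|]; [exact: closed_iota_ball|exact: closed0].
- move=> x /F0D h; have [|l hl] := @span_dist_lt R V N N_sub NN D (iota x) (e / 3).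
    by apply: (le_lt_trans h); rewrite divr_gt0.
  by exists (pickle l) => //; rewrite /B pickleK /=; exact: ltW.
move: F0z => [g0 Gg0 g0z].
have F0u n' : F0 (u n') by have [_ <-] := sP n'; exists (s n').
have cF0 : compact F0 by exact: (subclosed_compact clF0 cX).
have [y [[g1 Gg1 g1y] cly]] : F0 `&` cluster (u @ \oo) !=set0.
  by apply: cF0; exists 0%N => // n' _; exact: F0u.
have linv := @left_inverse R X T hX cX Tcont F x0 clF Fx0 FT Fmin psi psiM G.
have [h Gh hg1] := linv g1 GS clG GG Gg1.
(* With [h] undoing [g1], this [k] maps [y = g1 x0] to [z = g0 x0]. *)
pose k := pcomp g0 h; have Gk : G k by exact: GG.
have [h' Gh' hk] := linv k GS clG GG Gk.
have ky : U (k y) by rewrite /k /pcomp -g1y hg1// g0z.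
have nUy : nbhs y (k @^-1` U).
  by apply: (Tcont (GS _ Gk)); exact: open_nbhs_nbhs.
have freq M : exists2 i, (M <= i)%N & U (k (u i)).
  have uM : (u @ \oo) [set u i | i in [set i | (M <= i)%N]].
    by exists M => // i /= Mi; exists i.
  by have [_ [[i Mi <-] Ui]] := cly _ _ uM nUy; exists i.
have [i _ Ui] := freq 0%N; have [j ij Uj] := freq i.+1.
have Bk i' : U (k (u i')) -> B n (k (u i')).
  move=> Ui'; apply: UB; split=> //; have [_ <-] := sP i'.
  by exists (pcomp k (s i')) => //; exact: GG.
have := Bk _ Ui; have := Bk _ Uj; rewrite /B; case: unpickle => [l|//] /= hj hi.
have := usep i j ij; apply/negP; rewrite -ltNge.
have := closure_nonexpansive (k (u j)) (k (u i)) (GS _ Gh').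
rewrite !hk// => hji.
apply: (le_lt_trans hji).
apply: (le_lt_trans (seminorm_triangle N_sub _ (ratcomb D l) _)).
by rewrite [X in _ + X](seminorm_distC NN); lra.
Qed.

End Minimal.

Hypothesis convexX : forall x y t, 0 <= t <= 1 ->
  exists z, iota z = t *: iota x + (1 - t) *: iota y.

(** Convexity read off through [iota], as [X] itself carries no linear
structure. *)
Definition convex_in (A : set X) := forall x y z t, A x -> A y -> 0 <= t <= 1 ->
  iota z = t *: iota x + (1 - t) *: iota y -> A z.

Lemma barycenter (A : set X) z0 l : convex_in A -> A z0 ->
  (forall z, z \in l -> A z) -> exists2 u, A u &
  (size l).+1%:R *: iota u = \sum_(z <- z0 :: l) iota z.
Proof.
move=> cA Az0; elim: l => [|a l IH] Al.
  by exists z0; rewrite ?big_seq1// scale1r.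
have [z zl|u Au uE] := IH; first by apply: Al; rewrite inE zl orbT.
pose t : R := (size l).+2%:R^-1.
have n0 : (size l).+2%:R != 0 :> R by rewrite pnatr_eq0.
have t01 : 0 <= t <= 1 by rewrite invr_ge0 ler0n invf_le1 ?ltr0n// ler1n.
have [z zE] := convexX a u t01.
exists z; first by apply: (cA a u z t) => //; apply: Al; rewrite mem_head.
rewrite [size _]/= zE scalerDr !scalerA mulrBr mulr1 divff// scale1r.
have -> : (size l).+2%:R - 1 = (size l).+1%:R :> R by rewrite -[in LHS]natr1 addrK.
by rewrite uE !big_cons addrCA.
Qed.

Lemma sum_le_with_half (f : X -> R) (l : seq X) d : (forall z, z \in l -> f z <= d) ->
  (exists2 z, z \in l & f z <= d / 2) ->
  \sum_(z <- l) f z <= (size l)%:R * d - d / 2.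
Proof.
move=> fd [z zl fz]; rewrite (big_rem z zl)/=.
have : \sum_(y <- rem z l) f y <= \sum_(y <- rem z l) d.
  by rewrite big_seq [leRHS]big_seq; apply: ler_sum => y /mem_rem; exact: fd.
rewrite big_const_seq count_predT iter_addr_0 size_rem// -mulr_natl.
have : (0 < size l)%N by case: l zl {fd}.
case: (size l) => // n _ /=; rewrite -[n.+1%:R]natr1; lra.
Qed.

(** With [K] and [F] minimal as chosen below, the diameter [d] of [F] must be zero.
If not, take a [d / 2]-net of [F] with [n] points. Each point of [F] is at
distance at most [d] from the points of the net, and at most [d / 2] from one of
them, so it is at distance at most [r = d - d / 2 / n] from their barycenter.
The points of [K] within [r] of all of [F] form a closed convex set, which is
invariant because every element of [T] maps [F] onto itself. This set is all of
[K], and as [K] contains [F], the diameter of [F] is at most [r]. *)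
Lemma fixed_point_of_means :
  (exists x : X, True) ->
  (forall x, exists psi : (X -> R) -> R, orbit_mean T x psi) ->
  exists x, forall t, T t -> t x = x.
Proof.
move=> [x1 _] means.
pose Q A := invariant T A /\ convex_in A.
have [| | | |K [_ clK K0 [KT Kc] Kmin]] := @compact_minimal X Q setT cX.
- exact: closedT.
- by exists x1.
- by split.
- move=> C _ CQ; split.
    by move=> t y Tt Cy A CA; have [AT _] := CQ _ CA; apply: AT => //; exact: Cy.
  move=> x y z t Cx Cy t01 zE A CA; have [_ Ac] := CQ _ CA.
  by apply: (Ac x y z t) => //; [exact: Cx|exact: Cy].
have [| |F [FK clF [x0 Fx0] FT Fmin]] :=
    @compact_minimal X (invariant T) K _ clK K0 KT.
- exact: (subclosed_compact clK cX).
- by move=> C _ CQ t y Tt Cy A CA; apply: (CQ A CA t y Tt); exact: Cy.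
have [psi psiM] := means x0.
have tb := minimal_totally_bounded clF Fx0 FT Fmin psiM.
pose E := [set N (iota p.1 - iota p.2) | p in [set p : X * X | F p.1 /\ F p.2]].
have [M FM] : exists M, forall x, F x -> N (iota x) <= M.
  have [l [_ hl]] := tb 1 ltr01.
  exists (1 + \sum_(z <- l) N (iota z)) => x Fx; have [z zl xz] := hl x Fx.
  rewrite -[iota x](subrK (iota z)); apply: (le_trans (seminormD N_sub _ _)).
  apply: lerD; first exact: ltW.
  rewrite (big_rem z zl)/= lerDl; apply: sumr_ge0 => ? _; exact: seminorm_ge0.
have Esup : has_sup E.
  split; first by exists (N (iota x0 - iota x0)), (x0, x0).
  exists (M + M) => _ [[x y] /= [Fx Fy] <-].
  by apply: (le_trans (seminormD N_sub _ _)); rewrite NN lerD ?FM.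
pose d := sup E.
have Fd x y : F x -> F y -> N (iota x - iota y) <= d.
  by move=> Fx Fy; apply: sup_upper_bound => //; exists (x, y).
have [d0|d0] := leP d 0.
  exists x0 => t Tt; apply: iota_inj; apply/eqP; rewrite -subr_eq0; apply/eqP/N0.
  apply/eqP; rewrite eq_le seminorm_ge0// andbT; apply: le_trans d0; apply: Fd => //.
  exact: FT.
exfalso.
have [l [lF lnet]] : exists l : seq X, (forall z, z \in l -> F z) /\
    forall y, F y -> exists2 z, z \in l & N (iota y - iota z) < d / 2.
  by apply: tb; rewrite divr_gt0.
case: l lF lnet => [|z0 l] lF lnet; first by have [] := lnet x0 Fx0.
have [|u Ku uE] := @barycenter K z0 l Kc (FK _ (lF _ (mem_head _ _))).
  by move=> z zl; apply/FK/lF; rewrite inE zl orbT.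
pose n : R := (size l).+1%:R; have n0 : 0 < n by rewrite ltr0n.
pose r := d - d / 2 / n.
have rd : r < d by rewrite /r ltrBlDr ltrDl !divr_gt0.
have ur y : F y -> N (iota u - iota y) <= r.
  move=> Fy; rewrite -(ler_pM2l n0).
  have [_ Nh] := N_sub; rewrite -(Nh _ _ (ltW n0)) scalerBr uE.
  have -> : n *: iota y = \sum_(z <- z0 :: l) iota y.
    by rewrite big_const_seq count_predT iter_addr_0 scaler_nat.
  rewrite -sumrB; apply: (@le_trans _ _ (\sum_(z <- z0 :: l) N (iota z - iota y))).
    elim: (z0 :: l) => [|a l' IH]; first by rewrite !big_nil sublinear0.
    by rewrite !big_cons; apply: (le_trans (seminormD N_sub _ _)); rewrite lerD2l.
  apply: (le_trans
    (@sum_le_with_half (fun z => N (iota z - iota y)) (z0 :: l) d _ _)).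
  - by move=> z zl; apply: Fd => //; exact: lF.
  - by have [z zl yz] := lnet y Fy; exists z => //; rewrite (seminorm_distC NN) ltW.
  by rewrite /r mulrBr mulrCA divff ?gt_eqF// mulr1.
pose K' := K `&` \bigcap_(y in F) [set x | N (iota x - iota y) <= r].
have K'K : K' = K.
  apply: Kmin.
  - by move=> x [].
  - by apply: closedI => //; apply: closed_bigI => y _; exact: closed_iota_ball.
  - by exists u; split => // y Fy; exact: ur.
  - split.
      move=> t x Tt [Kx xr]; split; first exact: KT.
      move=> y Fy /=.
      have [z Fz <-] := @Sigma_surjective R X T hX cX Tcont F x0 clF Fx0 FT Fmin
        psi psiM t y (subset_closure Tt) Fy.
      exact: le_trans (Tnonexp _ _ Tt) (xr z Fz).
    move=> x y z t [Kx xr] [Ky yr] t01 zE; split; first exact: (Kc x y z t).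
    move=> w Fw /=; have /andP[t0 t1] := t01.
    have -> : iota z - iota w =
        t *: (iota x - iota w) + (1 - t) *: (iota y - iota w).
      by rewrite zE !scalerBr addrACA -opprD -scalerDl addrCA subrr addr0 scale1r.
    have [_ Nh] := N_sub; have s0 : 0 <= 1 - t by rewrite subr_ge0.
    apply: (le_trans (seminormD N_sub _ _)); rewrite !Nh//.
    have h1 := ler_wpM2l t0 (xr w Fw); have h2 := ler_wpM2l s0 (yr w Fw).
    by apply: (le_trans (lerD h1 h2)); rewrite -mulrDl addrCA subrr addr0 mul1r.
have : d <= r.
  apply: ge_sup; first exact: Esup.1.
  move=> _ [[x y] /= [Fx Fy] <-]; have : K x by exact: FK.
  by rewrite -K'K => -[_ /(_ y Fy)].
by rewrite leNgt rd.
Qed.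

End FixedPoint.

(** * Complex numbers and their real and imaginary parts *)

Section ComplexScalars.
Variable R : realType.
Implicit Types z w : R[i].

Lemma normc_ge_absRe z : `|complex.Re z| <= normc z.
Proof. by rewrite -lecR; exact: normc_ge_Re. Qed.

Lemma Re_le_normc z : complex.Re z <= normc z.
Proof. exact: le_trans (ler_norm _) (normc_ge_absRe z). Qed.

Lemma normc_i : normc ('i%C : R[i]) = 1.
Proof. by rewrite /normc /= expr0n /= add0r expr1n sqrtr1. Qed.

Lemma normc_ge_absIm z : `|complex.Im z| <= normc z.
Proof.
have := normc_ge_absRe (z * 'i%C).
by rewrite ReiNIm normrN normcM normc_i mulr1.
Qed.

Lemma normc_le_ReIm z : normc z <= `|complex.Re z| + `|complex.Im z|.
Proof.
case: z => a b /=; rewrite -[leRHS]ger0_norm ?addr_ge0// -sqrtr_sqr ler_wsqrtr//.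
rewrite sqrrD !real_normK ?num_real// -addrA lerD2l lerDr.
by rewrite mulrn_wge0// mulr_ge0.
Qed.

Lemma normc_real (a : R) : normc a%:C = `|a|.
Proof. by rewrite /normc /= expr0n /= addr0 sqrtr_sqr. Qed.

Lemma ReD z w : complex.Re (z + w) = complex.Re z + complex.Re w.
Proof. by case: z w => [? ?] [? ?]. Qed.

Lemma ImD z w : complex.Im (z + w) = complex.Im z + complex.Im w.
Proof. by case: z w => [? ?] [? ?]. Qed.

Lemma ReN z : complex.Re (- z) = - complex.Re z.
Proof. by case: z. Qed.

Lemma ImN z : complex.Im (- z) = - complex.Im z.
Proof. by case: z. Qed.

Lemma ReZ (a : R) z : complex.Re (a%:C * z) = a * complex.Re z.
Proof. by case: z => [? ?] /=; rewrite mul0r subr0. Qed.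

Lemma ImZ (a : R) z : complex.Im (a%:C * z) = a * complex.Im z.
Proof. by case: z => [? ?] /=; rewrite mul0r addr0. Qed.

Lemma complex_ball (e : R[i]) : 0 < e -> exists2 r : R, 0 < r & e = r%:C.
Proof.
move=> e0; have er : e \is Num.real by exact: gtr0_real.
exists (complex.Re e); last by rewrite RRe_real.
by rewrite -ltcR RRe_real.
Qed.

Lemma complex_cvg (T : topologicalType) (f : T -> R[i]^o) (F : set_system T)
    (l : R[i]^o) : Filter F ->
  (forall e : R, 0 < e -> \forall t \near F, normc (l - f t) < e) ->
  f @ F --> l.
Proof.
move=> FF h; apply/cvgrPdist_lt => e /complex_ball[r r0 ->].
by apply: filterS (h r r0) => t; rewrite -ltcR.
Qed.

End ComplexScalars.

(** * Functions on the semigroup defined along an orbit *)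

Section OrbitFunctions.
Variables (R : realType) (S : semitopSemigroupType) (X : topologicalType).
Variable act : S -> X -> X.
Hypothesis cX : compact [set: X].
Hypothesis actM : forall s t x, act s (act t x) = act (s * t)%g x.
Hypothesis act_cont : continuous (fun p : S * X => act p.1 p.2).
Let A : set {ptws X -> X} := range act.
Hypothesis Acont : forall t, closure A t -> continuous (t : X -> X).
Variable x : X.
Local Notation C := (Cb R S).

(** The function [s |-> f (act s x)] as an element of C(S). The default value makes
it a total function of [f], of interest for continuous [f] only. *)
Definition orb (f : X -> R) : C := insubd 0 (fun s => (f (act s x))%:C : R[i]^o).

Lemma act_continuousl y : continuous (act^~ y).
Proof.
move=> s; apply: (@continuous_comp _ _ _ (fun s => (s, y))
  (fun p : S * X => act p.1 p.2)).
  by apply: cvg_pair; [exact: cvg_id|exact: cvg_cst].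
exact: act_cont.
Qed.

Lemma orbE (f : X -> R) : continuous f ->
  orb f = (fun s => (f (act s x))%:C) :> (S -> R[i]^o).
Proof.
move=> cf; apply: insubdK; apply/Cb_predP; split.
  move=> s; apply: complex_cvg => e e0.
  have cfs : (fun s => f (act s x)) @ s --> f (act s x).
    by apply: (@continuous_comp _ _ _ (act^~ x) f); [exact: act_continuousl|exact: cf].
  move/cvgrPdist_lt/(_ e e0): cfs; apply: filterS => t.
  by rewrite -rmorphB normc_real.
have [M fM] := continuous_bounded x cX cf.
by exists M => s; rewrite normc_real.
Qed.

Lemma orb_lin (a : R) (f g : X -> R) : continuous f -> continuous g ->
  orb (fun y => a * f y + g y) = a%:C *: orb f + orb g.
Proof.
move=> cf cg; apply/val_inj; rewrite /= orbE.
  by apply/funext => s; rewrite !fctE /= !orbE// rmorphD rmorphM.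
by move=> y; apply: cvgD; [apply: cvgM; [exact: cvg_cst|exact: cf]|exact: cg].
Qed.

Lemma continuous_comp_act (f : X -> R) t : continuous f -> closure A t ->
  continuous (f \o t).
Proof.
by move=> cf /Acont ct y; apply: continuous_comp; [exact: ct|exact: cf].
Qed.

Lemma continuous_comp_act_s (f : X -> R) s : continuous f ->
  continuous (f \o act s).
Proof.
by move=> cf; apply: continuous_comp_act => //; apply: subset_closure; exists s.
Qed.

Lemma ltrans_orb s (f : X -> R) : continuous f ->
  ltrans s (orb f) = orb (f \o act s).
Proof.
move=> cf; apply/val_inj/funext => t /=.
rewrite !orbE//; last exact: continuous_comp_act_s.
by rewrite /= actM.
Qed.

Lemma supnorm_orb (f : X -> R) M : 0 <= M -> continuous f ->
  (forall y, `|f y| <= M) -> supnorm (orb f) <= M.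
Proof.
by move=> M0 cf fM; apply: supnorm_le => // s; rewrite orbE// normc_real.
Qed.

(** A tube lemma: by joint continuity the translate varies little near each point
of [X], and by compactness the neighbourhood of [s0] can be chosen independently
of the point. *)
Lemma orb_LUC (f : X -> R) : continuous f -> LUC R S (orb f).
Proof.
move=> cf s0; apply/cvgrPdist_lt => e /complex_ball[r r0 ->].
have r2 : 0 < r / 2 by rewrite divr_gt0.
pose P s y := `|f (act s0 y) - f (act s y)| < r / 2.
have cfa : continuous (fun p : S * X => f (act p.1 p.2)).
  by move=> p; apply: continuous_comp; [exact: act_cont|exact: cf].
have near_s0 : \near s0, [set: X] `<=` P s0.
  apply: ((compact_near_coveringP _).1 cX) => y _.
  have /cvgrPdist_lt/(_ (r / 2 / 2)) := cfa (s0, y).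
  rewrite divr_gt0// => /(_ isT) [[U W] [/= Us0 Wy] UW].
  exists (W, U) => //= -[y' s] [/= Wy' Us]; rewrite /P.
  have := UW (s0, y') (conj (nbhs_singleton Us0) Wy').
  have := UW (s, y') (conj Us Wy'); rewrite /= => h1 h2.
  rewrite (splitr (r / 2)) (_ : _ - _ =
    (f (act s0 y) - f (act s y')) - (f (act s0 y) - f (act s0 y'))); last by lra.
  by apply: (le_lt_trans (ler_normB _ _)); exact: ltrD.
apply: filterS near_s0 => s Ps.
rewrite !ltrans_orb//.
rewrite -[X in X < _]/((supnorm (orb (f \o act s0) - orb (f \o act s)))%:C) ltcR.
have r2r : r / 2 < r by lra.
apply: le_lt_trans r2r; apply: supnorm_le; first exact: ltW.
move=> t; rewrite /= !fctE !orbE//; try exact: continuous_comp_act_s.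
by rewrite -rmorphB normc_real ltW//; exact: Ps.
Qed.

End OrbitFunctions.

Section WeakCb.
Variables (R : realType) (S : topologicalType).
Local Notation C := (Cb R S).

Lemma dual_bounded (phi : dual C) : exists2 c : R, 0 <= c &
  forall g : C, normc (sval phi g) <= c * supnorm g.
Proof.
have cphi := svalP phi.
have /linear_boundedP near_oo := continuous_linear_bounded 0 (cphi 0).
have [r r0 hr] := pinfty_ex_gt (real0 R[i]) near_oo.
have [c c0 rc] := complex_ball r0.
exists c; first exact: ltW.
move=> g; rewrite -lecR rmorphM /= -rc; exact: hr.
Qed.

(** Evaluations are named in order to be registered as linear maps; they show that
the weak topology of C(S) separates points. *)
Definition Cb_ev (s : S) (f : C) : R[i]^o := f s.

Lemma Cb_ev_linear s : linear (Cb_ev s).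
Proof. by []. Qed.

HB.instance Definition _ s :=
  GRing.isLinear.Build R[i] C R[i]^o _ (Cb_ev s) (Cb_ev_linear s).

Lemma Cb_ev_continuous s : continuous (Cb_ev s).
Proof.
move=> f.
apply: (@complex_cvg R C (Cb_ev s) (nbhs f) (Cb_ev s f) (nbhs_filter f)) => e e0.
have /cvgrPdist_lt/(_ e%:C) : (fun g : C => g) @ f --> f by exact: cvg_id.
rewrite ltcR => /(_ e0); apply: filterS => g.
rewrite -[X in X < _ -> _]/((supnorm (f - g))%:C) ltcR; apply: le_lt_trans.
exact: (supnorm_ub (f - g) s).
Qed.

Lemma dual_weak_continuous (K : numFieldType) (E : normedModType K) (phi : dual E) :
  continuous (fun v : weak E => sval phi v : K^o).
Proof.
move=> v.
have /cvg_sup/(_ phi) h : (fun w : weak E => w) @ v --> (v : weak E).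
  exact: cvg_id.
move=> B nB.
have hB := @initial_continuous _ _ (sval phi : E -> K^o) v B nB.
exact: (h (nbhs_filter v) _ hB).
Qed.

Lemma weak_Cb_hausdorff : hausdorff_space (weak C).
Proof.
move=> f g clfg; apply/val_inj/funext => s /=.
pose phi : dual C := exist _ (Cb_ev s : {linear C -> R[i]^o}) (@Cb_ev_continuous s).
have cphi := @dual_weak_continuous _ _ phi.
apply: (@norm_hausdorff _ R[i]^o) => U W Uf Wg.
have [z [Uz Wz]] := clfg _ _ (cphi f _ Uf) (cphi g _ Wg).
by exists (z s).
Qed.

End WeakCb.

Section OrbitWAP.
Variables (R : realType) (S : semitopSemigroupType) (X : topologicalType).
Variable act : S -> X -> X.
Hypothesis cX : compact [set: X].
Hypothesis actM : forall s t x, act s (act t x) = act (s * t)%g x.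
Hypothesis act_cont : continuous (fun p : S * X => act p.1 p.2).
Let A : set {ptws X -> X} := range act.
Hypothesis Acont : forall t, closure A t -> continuous (t : X -> X).
Variable x : X.
Local Notation C := (Cb R S).
Local Notation orb := (@orb R S X act x).

(** Grothendieck's theorem, applied to the real and to the imaginary part of the
functional [f |-> phi (orb f)]. *)
Lemma orb_dual_continuous (f : X -> R) (phi : dual C) s (e : R) : continuous f ->
  closure A s -> 0 < e -> \forall t \near s, closure A t ->
    normc (sval phi (orb (f \o s)) - sval phi (orb (f \o t))) < e.
Proof.
move=> cf As e0; have [c c0 hc] := dual_bounded phi.
have e2 : 0 < e / 2 by rewrite divr_gt0.
have cfA t : closure A t -> continuous (f \o t) by exact: continuous_comp_act.
have [M fM] : exists M, forall y, `|f y| <= M.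
  exact: (continuous_bounded x cX cf).
have phil (a : R) (g h : X -> R) : continuous g -> continuous h ->
    sval phi (orb (fun y => a * g y + h y)) =
    a%:C * sval phi (orb g) + sval phi (orb h).
  by move=> cg ch; rewrite orb_lin// linearP.
have phib (g : X -> R) N : continuous g -> (forall y, `|g y| <= N) ->
    normc (sval phi (orb g)) <= c * N.
  move=> cg gN; apply: (le_trans (hc _)); apply: ler_wpM2l => //.
  by apply: supnorm_orb => //; exact: le_trans (normr_ge0 _) (gN x).
have gr (P : R[i] -> R) : (forall (a : R) z w, P (a%:C * z + w) = a * P z + P w) ->
    (forall z, `|P z| <= normc z) ->
    \forall t \near s, closure A t ->
      `|P (sval phi (orb (f \o t))) - P (sval phi (orb (f \o s)))| < e / 2.
  move=> Pl Pb.
  apply: (@grothendieck R X {ptws X -> X} (fun g => P (sval phi (orb g))) c M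
    (closure A) (fun t => f \o t)) => //.
  - by move=> a g h cg ch; rewrite phil// Pl.
  - by move=> g N cg gN; apply: (le_trans (Pb _)); exact: phib.
  - by apply: Sigma_compact => //; exact: closed_closure.
  - move=> y t; apply: (@continuous_comp _ _ _ (fun t : {ptws X -> X} => t y)).
      exact: ev_continuous.
    exact: cf.
  - by move=> t y _; exact: fM.
have hRe := gr (@complex.Re R) _ (@normc_ge_absRe R).
have hIm := gr (@complex.Im R) _ (@normc_ge_absIm R).
have {hRe}hRe := hRe (fun a z w => etrans (ReD _ _) (congr1 (+%R^~ _) (ReZ _ _))).
have {hIm}hIm := hIm (fun a z w => etrans (ImD _ _) (congr1 (+%R^~ _) (ImZ _ _))).
apply: filterS2 hRe hIm => t hR hI At.
apply: (le_lt_trans (normc_le_ReIm _)); rewrite (splitr e).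
rewrite ReD ReN ImD ImN [X in X + _]distrC [X in _ + X]distrC.
by apply: ltrD; [exact: hR|exact: hI].
Qed.

(** The left translates of [orb f] are the functions [orb (f \o act s)]. They belong
to the image, under a weakly continuous map, of the compact closure of the
action. *)
Lemma orb_WAP (f : X -> R) : continuous f -> WAP R S (orb f).
Proof.
move=> cf; pose Phi (t : {ptws X -> X}) : weak C := orb (f \o t).
have cPhi : compact (Phi @` closure A).
  apply: continuous_compact; last by apply: Sigma_compact => //; exact: closed_closure.
  apply/subspace_continuousP => s As; apply/cvg_sup => phi; apply: cvg_initial.
  apply: complex_cvg => e e0; exact: orb_dual_continuous.
exists (Phi @` closure A).
  move=> _ [s _ <-]; exists (act s); first by apply: subset_closure; exists s.
  by rewrite /Phi (@ltrans_orb R S X act cX actM act_cont Acont x s f cf).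
split=> //; apply: compact_closed => //; exact: weak_Cb_hausdorff.
Qed.

End OrbitWAP.

(** * From a left invariant mean to a fixed point *)

Section MeanOfLIM.
Variables (R : realType) (S : semitopSemigroupType) (X : topologicalType).
Variable act : S -> X -> X.
Hypothesis cX : compact [set: X].
Hypothesis actM : forall s t x, act s (act t x) = act (s * t)%g x.
Hypothesis act_cont : continuous (fun p : S * X => act p.1 p.2).
Let A : set {ptws X -> X} := range act.
Hypothesis Acont : forall t, closure A t -> continuous (t : X -> X).
Variable m : Cb R S -> R[i].
Hypothesis mL : left_invariant_mean (WAP R S `&` LUC R S) m.

(** The functional is [f |-> Re (m (orb f))]. For positivity, [f >= 0] is scaled to
take values between 0 and 1; then [1 - f] has norm at most 1, so its mean has real
part at most [1 = m 1]. *)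
Theorem orbit_mean_of_LIM (x : X) :
  exists psi : (X -> R) -> R, orbit_mean (A `|` [set id]) x psi.
Proof.
have [mlin mnorm m1 minv] := mL.
pose orbx := @orb R S X act x.
have oX f : continuous f -> (WAP R S `&` LUC R S) (orbx f).
  by move=> cf; split; [exact: orb_WAP|exact: orb_LUC].
have c0 (r : R) : continuous (cst r : X -> R) by move=> y; exact: cvg_cst.
have o1 : orbx (cst 1) = Cb_cst S 1.
  by apply/val_inj; rewrite /= /orbx orbE.
have m0 : m (orbx (cst 0)) = 0.
  have := mlin (- 1) _ _ (oX _ (c0 0)) (oX _ (c0 0)).
  by rewrite scaleN1r addNr mulN1r addNr => <-; congr m;
    apply/val_inj; rewrite /= /orbx orbE.
have plin (a : R) (f g : X -> R) : continuous f -> continuous g ->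
    complex.Re (m (orbx (fun y => a * f y + g y))) =
    a * complex.Re (m (orbx f)) + complex.Re (m (orbx g)).
  move=> cf cg; rewrite /orbx orb_lin// mlin; [|exact: oX|exact: oX].
  by rewrite ReD ReZ.
have mle1 f : continuous f -> (forall y, `|f y| <= 1) ->
    complex.Re (m (orbx f)) <= 1.
  move=> cf f1; apply: (le_trans (Re_le_normc _)); rewrite -lee_fin -mnorm.
  apply: ereal_sup_ubound; exists (orbx f) => //; split; first exact: oX.
  by rewrite -[X in X <= _]/((supnorm (orbx f))%:C) lecR; exact: supnorm_orb.
exists (fun f => complex.Re (m (orbx f))); split.
- exact: plin.
- by rewrite o1 m1.
- move=> f cf f0.
  have [M fM] := continuous_bounded x cX cf.
  have M1 : 0 < M + 1 by rewrite ltr_wpDl//; exact: le_trans (normr_ge0 _) (fM x).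
  have cg : continuous (fun y => - (M + 1)^-1 * f y + cst 1 y).
    move=> y; apply: cvgD; last exact: c0.
    by apply: cvgM; [exact: cvg_cst|exact: cf].
  have := mle1 _ cg; rewrite plin// o1 m1 /= gerDr mulNr oppr_le0.
  rewrite pmulr_rge0 ?invr_gt0//; apply=> y.
  have h : 0 <= (M + 1)^-1 * f y <= 1.
    rewrite mulr_ge0 ?invr_ge0 ?(ltW M1)//= ler_pdivrMl// mulr1.
    by apply: (le_trans (ler_norm _)); apply: (le_trans (fM y)); rewrite lerDl.
  by move/andP: h => [h1 h2]; rewrite mulNr /= ler_norml; apply/andP; split; lra.
- move=> f _ cf [[s _ <-]|->]; last by [].
  by rewrite /orbx -ltrans_orb// minv//; exact: oX.
- move=> f cf f0; suff -> : orbx f = orbx (cst 0) by rewrite m0.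
  apply/val_inj; rewrite /= /orbx !orbE//; apply/funext => s.
  by rewrite f0//; left; exists s.
Qed.

End MeanOfLIM.

Lemma compact_set_type (X : topologicalType) (A : set X) :
  compact A -> compact [set: A].
Proof.
move=> cA F FF _.
have FG : (val @ F) A.
  apply: (@filterS _ F _ [set: A]); last exact: filterT.
  by move=> a _; exact: set_valP.
have [a [Aa cla]] := cA _ (fmap_proper_filter val FF) FG.
exists (exist _ a (mem_set Aa)); split=> // U B FU [_ [[W oW <-] Wa WB]].
have FvU : (val @ F) [set val u | u in U].
  by apply: (@filterS _ F _ U) => // u Uu /=; exists u.
have [_ [[u Uu <-] Wu]] := cla _ _ FvU (open_nbhs_nbhs (conj oW Wa)).
by exists u; split=> //; exact: WB.
Qed.

(** The identity is adjoined to the action to obtain a monoid. This adds only the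
identity to the closure, because a point is closed in a Hausdorff space. *)
Theorem fixed_point_of_LIM (R : realType) (S : semitopSemigroupType)
    (V : lmodType R) (N : V -> R) (X : topologicalType) (iota : X -> V)
    (act : S -> X -> X) (m : Cb R S -> R[i]) :
  left_invariant_mean (WAP R S `&` LUC R S) m ->
  sublinear N -> (forall v, N (- v) = N v) -> (forall v, N v = 0 -> v = 0) ->
  injective iota -> weakly_continuous N iota -> compact [set: X] ->
  (exists x : X, True) ->
  (forall x y t, 0 <= t <= 1 ->
    exists z, iota z = t *: iota x + (1 - t) *: iota y) ->
  (forall s t x, act s (act t x) = act (s * t)%g x) ->
  continuous (fun p : S * X => act p.1 p.2) ->
  (forall t, closure (range act : set {ptws X -> X}) t ->
    continuous (t : X -> X)) ->
  (forall s x y, N (iota (act s x) - iota (act s y)) <= N (iota x - iota y)) ->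
  exists x, forall s, act s x = x.
Proof.
move=> mL Nsub NN N0 inj ci cX X0 cvx actM cact cS nexp.
pose T : set {ptws X -> X} := range act `|` [set id].
have hX := weakly_continuous_hausdorff Nsub N0 inj ci.
have [| | | | |x hx] :=
    @fixed_point_of_means R V N Nsub NN N0 X iota inj ci cX T _ _ _ _ cvx X0.
- move=> _ _ [[s _ <-]|->] [[t _ <-]|->]; last by right.
  + by left; exists (s * t)%g => //; apply/funext => x; rewrite -actM.
  + by left; exists s.
  + by left; exists t.
- by right.
- rewrite closureU => t [/cS//|].
  rewrite -(closure_id _).1; last first.
    exact: accessible_closed_set1 (hausdorff_accessible (ptws_hausdorff hX)) _.
  by move=> -> x; exact: cvg_id.
- by move=> _ x y [[s _ <-]|->].
- by move=> x; apply: orbit_mean_of_LIM mL x.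
by exists x => s; apply: hx; left; exists s.
Qed.

(** * Real and complex Banach spaces *)

Section RealScalars.
Variables (R : realType) (E : normedModType R) (A : set (weak E)).

(** A functional below the norm is continuous for the norm, hence belongs to the
dual space, and elements of the dual are weakly continuous by definition. *)
Lemma real_weakly_continuous :
  weakly_continuous (fun v : E => `|v|) (fun a : A => (\val a : E)).
Proof.
move=> phi [phil phiN].
pose isl := GRing.isLinear.Build R E R^o _ (phi : E -> R^o) phil.
pose phiL : {linear E -> R^o} := HB.pack (phi : E -> R^o) isl.
have cphi : continuous (phiL : E -> R^o).
  move=> v; apply/cvgrPdist_lt => e e0.
  have /cvgrPdist_lt/(_ e e0) : (fun w : E => w) @ v --> v by exact: cvg_id.
  apply: filterS => w; apply: le_lt_trans; rewrite -linearB /= ler_norml phiN andbT.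
  by rewrite lerNl -normrN; have := phiN (- (v - w)); rewrite -[phi _]/(phiL _) linearN.
move=> a.
apply: (@continuous_comp _ _ _ (\val : A -> weak E) (phi : weak E -> R^o)).
  exact: initial_continuous.
exact: (@dual_weak_continuous R E (exist _ phiL cphi)).
Qed.

End RealScalars.

Section Realification.
Variable R : realType.

(** A complex space with scalars restricted to the reals. A separate name is
needed, as one type cannot carry both module structures. *)
Definition realified (E : lmodType R[i]) : Type := E.

HB.instance Definition _ (E : lmodType R[i]) := GRing.Zmodule.on (realified E).

Section Instance.
Variable E : lmodType R[i].

Definition real_scale (a : R) (v : realified E) : realified E := a%:C *: (v : E).

Lemma real_scaleA a b v : real_scale a (real_scale b v) = real_scale (a * b) v.
Proof. by rewrite /real_scale scalerA -rmorphM. Qed.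

Lemma real_scale1 : left_id 1 real_scale.
Proof. by move=> v; rewrite /real_scale scale1r. Qed.

Lemma real_scaleDr : right_distributive real_scale +%R.
Proof. by move=> a v w; rewrite /real_scale scalerDr. Qed.

Lemma real_scaleDl v : {morph real_scale^~ v : a b / a + b}.
Proof. by move=> a b; rewrite /real_scale rmorphD scalerDl. Qed.

HB.instance Definition _ := GRing.Zmodule_isLmodule.Build R (realified E)
  real_scaleA real_scale1 real_scaleDr real_scaleDl.

End Instance.

Section Norm.
Variable E : normedModType R[i].

Definition real_norm (v : realified E) : R := complex.Re `|v : E|.

Lemma real_normE (v : E) : `|v| = (real_norm v)%:C.
Proof. by rewrite /real_norm RRe_real// normr_real. Qed.

Lemma real_norm_sublinear : sublinear real_norm.
Proof.
split=> [v w|t v t0].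
  by rewrite -lecR rmorphD /= -!real_normE; exact: ler_normD.
apply/complexI; rewrite rmorphM /= -!real_normE.
by rewrite [LHS]normrZ (ger0_norm (_ : 0 <= t%:C)) ?ler0c.
Qed.

Lemma real_normN (v : realified E) : real_norm (- v) = real_norm v.
Proof. by rewrite /real_norm normrN. Qed.

Lemma real_norm_eq0 (v : realified E) : real_norm v = 0 -> v = 0.
Proof.
move=> v0; apply/eqP; rewrite -[_ == _]/((v : E) == 0) -normr_eq0.
by rewrite real_normE v0.
Qed.

Variable A : set (weak E).

(** A real-linear functional [phi] is the real part of the complex-linear
functional [v |-> phi v - i * phi (i v)]. *)
Lemma complex_weakly_continuous :
  weakly_continuous real_norm (fun a : A => (\val a : realified E)).
Proof.
move=> phi [phil phiN].
have phiD (v w : E) : phi (v + w) = phi v + phi w.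
  by have := phil 1 v w; rewrite scale1r mul1r.
have phi0 : phi 0 = 0.
  have /eqP := phiD 0 0.
  by rewrite addr0 addrC -subr_eq subrr eq_sym => /eqP.
have phiZ (a : R) (v : E) : phi (a%:C *: v) = a * phi v.
  by have := phil a v 0; rewrite addr0 phi0 addr0.
pose phiC (v : E) : R[i]^o := (phi v +i* - phi ('i%C *: v))%C.
have phiCl : linear phiC.
  have scale_ab (a b : R) (v : E) :
      (a +i* b)%C *: v = a%:C *: v + b%:C *: ('i%C *: v).
    by rewrite scalerA -scalerDl [(a +i* b)%C]complexE /= [b%:C * _]mulrC.
  have ii (b : R) (v : E) : b%:C *: ('i%C *: ('i%C *: v)) = (- b)%:C *: v.
    by rewrite !scalerA -expr2 sqr_i mulrN1 rmorphN.
  move=> [a b] v w; rewrite /phiC scalerDr scalerA ['i%C * _]mulrC -scalerA.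
  rewrite (scale_ab a b v) (scale_ab a b ('i%C *: v)) ii !phiD !phiZ.
  by apply/eqP; rewrite eq_complex /=; apply/andP; split; apply/eqP; lra.
pose isl := GRing.isLinear.Build R[i] E R[i]^o _ phiC phiCl.
pose phiL : {linear E -> R[i]^o} := HB.pack phiC isl.
have absphi (v : E) : `|phi v| <= real_norm v.
  rewrite ler_norml phiN andbT lerNl -real_normN; apply: le_trans (phiN _).
  by have := phiZ (- 1) v; rewrite rmorphN scaleN1r mulN1r => ->.
have cphi : continuous (phiL : E -> R[i]^o).
  move=> v; apply/cvgrPdist_lt => e /complex_ball[r r0 ->].
  have r2 : 0 < (r / 2)%:C :> R[i] by rewrite ltcR divr_gt0.
  have /cvgrPdist_lt/(_ _ r2) : (fun w : E => w) @ v --> v by exact: cvg_id.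
  apply: filterS => w; rewrite -linearB real_normE ltcR => vw.
  rewrite -[X in X < _]/((normc (phiC (v - w)))%:C) ltcR.
  apply: (le_lt_trans (normc_le_ReIm _)); rewrite /= normrN (splitr r).
  apply: ltrD; first exact: le_lt_trans (absphi _) vw.
  apply: le_lt_trans (absphi _) _; apply: le_lt_trans vw.
  have i1 : `|'i%C : R[i]| = 1 by rewrite -[LHS]/((normc 'i%C)%:C) normc_i.
  by rewrite -lecR -!real_normE normrZ i1 mul1r.
have cC := @dual_weak_continuous R[i] E (exist _ phiL cphi).
move=> a; have FFa : Filter (nbhs a) := nbhs_filter a.
apply/cvgrPdist_lt => e e0.
have eC : 0 < e%:C :> R[i] by rewrite ltcR.
have ca : (fun b : A => phiC (\val b : E)) @ a --> phiC (\val a : E).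
  apply: (@continuous_comp _ _ _ (\val : A -> weak E) (phiC : weak E -> R[i]^o)).
    exact: initial_continuous.
  exact: cC.
move/cvgrPdist_lt/(_ _ eC): ca; apply: filterS => b.
rewrite -[X in X < _ -> _]/((normc (phiC (\val a) - phiC (\val b)))%:C) ltcR.
by apply: le_lt_trans; exact: (normc_ge_absRe (phiC (\val a) - phiC (\val b))).
Qed.

End Norm.
End Realification.

Theorem Fstar_real (R : realType) (S : semitopSemigroupType)
    (m : Cb R S -> R[i]) :
  left_invariant_mean (WAP R S `&` LUC R S) m -> Fstar S R.
Proof.
move=> mL E A act [a Aa] cA cvxA actM jc wq ne.
apply: (@fixed_point_of_LIM R S E (fun v => `|v|) A (fun a => \val a : E) act m mL).
- by split=> [v w|t v t0]; [exact: ler_normD|rewrite normrZ ger0_norm].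
- by move=> v; rewrite normrN.
- by move=> v /normr0_eq0.
- exact: val_inj.
- exact: real_weakly_continuous.
- exact: compact_set_type.
- by exists (exist _ a (mem_set Aa)).
- move=> x y t /andP[t0 t1].
  have Az := cvxA _ _ (Itv01 t0 t1) (valP x) (valP y).
  by exists (exist (fun v => v \in A) _ Az).
- exact: actM.
- exact: jc.
- exact: wq.
- exact: ne.
Qed.

Theorem Fstar_complex (R : realType) (S : semitopSemigroupType)
    (m : Cb R S -> R[i]) :
  left_invariant_mean (WAP R S `&` LUC R S) m -> Fstar S R[i].
Proof.
move=> mL E A act [a Aa] cA cvxA actM jc wq ne.
apply: (@fixed_point_of_LIM R S (realified E) (@real_norm R E) A
  (fun a => \val a : realified E) act m mL).
- exact: real_norm_sublinear.
- exact: real_normN.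
- exact: real_norm_eq0.
- exact: val_inj.
- exact: complex_weakly_continuous.
- exact: compact_set_type.
- by exists (exist _ a (mem_set Aa)).
- move=> x y t /andP[t0 t1].
  have t0C : 0 <= t%:C :> R[i] by rewrite ler0c.
  have t1C : t%:C <= 1 :> R[i] by rewrite lecR.
  have Az := cvxA _ _ (Itv01 t0C t1C) (valP x) (valP y).
  exists (exist (fun v => v \in A) _ Az) => /=.
  have t1E : (1 - t)%:C = 1 - t%:C :> R[i] by exact: rmorphB.
  exact: (congr1 (fun c : R[i] => t%:C *: (\val x : E) + c *: (\val y : E))
    (esym t1E)).
- exact: actM.
- exact: jc.
- exact: wq.
- by move=> s x y; rewrite -lecR -!real_normE; exact: ne.
Qed.

Theorem theorem3p3 (R : realType) (S : semitopSemigroupType) :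
  (exists m : Cb R S -> R[i], left_invariant_mean (WAP R S `&` LUC R S) m) ->
  Fstar S R /\ Fstar S R[i].
Proof.
by move=> [m mL]; split; [exact: Fstar_real mL|exact: Fstar_complex mL].
Qed.
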